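(* Let $X$ be a locally compact Hausdorff space and $\gamma:X\times X\to\mathbb{R}$ a continuous conditionally negative definite kernel. The kernel $G_{\gamma}:X\times X\to\mathbb{R}$, $G_{\gamma}(x,y)=e^{-\gamma(x,y)}$, is $C_{0}(X)$-universal if and only if $\gamma$ is metrizable and $\mathcal{H}_{G_{\gamma}}\subset C_{0}(X)$, where $\mathcal{H}_{G_{\gamma}}$ is the reproducing kernel Hilbert space of $G_{\gamma}$.
   Context: A kernel $\gamma:X\times X\to\mathbb{R}$ is conditionally negative definite (CND) if $\gamma(x,y)=\gamma(y,x)$ and $\sum_{\mu,\nu=1}^{n}c_{\mu}c_{\nu}\gamma(x_{\mu},x_{\nu})\le 0$ for all finitely many distinct points $x_{1},\dots,x_{n}$ and $c_{1},\dots,c_{n}\in\mathbb{R}$ with $\sum_{\mu}c_{\mu}=0$. Every CND kernel can be written $\gamma(x,y)=\|h(x)-h(y)\|^{2}_{\mathcal{H}}+f(x)+f(y)$ with $\mathcal{H}$ a real Hilbert space, $h:X\to\mathcal{H}$ and $f(x)=\gamma(x,x)/2$; $\gamma$ is called metrizable if $h$ is injective, equivalently if $2\gamma(x,y)>\gamma(x,x)+\gamma(y,y)$ for all $x\neq y$ in $X$. A kernel $K:X\times X\to\mathbb{C}$ is positive definite if $\sum_{\mu,\nu=1}^{n}c_{\mu}\overline{c_{\nu}}K(x_{\mu},x_{\nu})\ge 0$ for all finitely many distinct points $x_{\mu}\in X$ and scalars $c_{\mu}\in\mathbb{C}$. Its reproducing kernel Hilbert space $\mathcal{H}_{K}$ is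 the Hilbert space of functions $F:X\to\mathbb{C}$ that contains $K_{y}:=K(\cdot,y)$ for every $y\in X$, satisfies $\langle F,K_{y}\rangle_{\mathcal{H}_{K}}=F(y)$, and in which $\mathrm{span}\{K_{y}:y\in X\}$ is dense. $C_{0}(X)$ is the Banach space (sup norm) of continuous $f:X\to\mathbb{C}$ such that for every $\epsilon>0$ there is a compact set outside of which $|f|<\epsilon$. A positive definite kernel $K$ is $C_{0}$-universal (also written $C_{0}(X)$-universal) if $\mathcal{H}_{K}\subset C_{0}(X)$ and for every $g\in C_{0}(X)$ and $\epsilon>0$ there is $f\in\mathcal{H}_{K}$ with $\sup_{x\in X}|f(x)-g(x)|<\epsilon$. *)

(* Defs.v *)
From HB Require Import structures.
From mathcomp Require Import all_boot all_order all_algebra.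
From mathcomp Require Import complex.
From mathcomp Require Import all_classical all_reals all_analysis.

Set Implicit Arguments.
Unset Strict Implicit.
Unset Printing Implicit Defensive.

Import Order.TTheory GRing.Theory Num.Theory.
Import numFieldNormedType.Exports.

Local Open Scope classical_set_scope.
Local Open Scope ring_scope.
Local Open Scope complex_scope.

Section Kernels.
Context {R : realType}.

Definition cond_neg_def {X : Type} (g : X -> X -> R) : Prop :=
  (forall x y, g x y = g y x) /\
  forall (n : nat) (x : 'I_n -> X) (c : 'I_n -> R),
    injective x -> \sum_(i < n) c i = 0 ->
    \sum_(i < n) \sum_(j < n) c i * c j * g (x i) (x j) <= 0.

(* In any representation [g x y = `|h x - h y|^2 + g x x / 2 + g y y / 2] with
   [h] valued in a real Hilbert space, this says that [`|h x - h y|^2 > 0] for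
   [x <> y], i.e. that [h] is injective. *)
Definition metrizable {X : Type} (g : X -> X -> R) : Prop :=
  forall x y, x <> y -> g x x + g y y < 2 * g x y.

(* The order of [R[i]] is such that [0 <= z] means that [z] is real and
   nonnegative. *)
Definition pos_def {X : Type} (K : X -> X -> R[i]) : Prop :=
  forall (n : nat) (x : 'I_n -> X) (c : 'I_n -> R[i]),
    injective x ->
    0 <= \sum_(i < n) \sum_(j < n) c i * (c j)^* * K (x i) (x j).

Definition hnorm {X : Type} (ip : (X -> R[i]) -> (X -> R[i]) -> R[i])
  (F : X -> R[i]) : R := Num.sqrt (complex.Re (ip F F)).

(* [H] is a complex Hilbert space of functions on [X], under the pointwise
   operations and the inner product [ip], whose values outside [H] are
   irrelevant. *)
Record is_hilbert_fct {X : Type} (H : set (X -> R[i]))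
    (ip : (X -> R[i]) -> (X -> R[i]) -> R[i]) : Prop := IsHilbertFct {
  hilb0 : H 0 ;
  hilbD : forall F G, H F -> H G -> H (F + G) ;
  hilbZ : forall (a : R[i]) F, H F -> H (fun x => a * F x) ;
  ipDl : forall F G L, H F -> H G -> H L -> ip (F + G) L = ip F L + ip G L ;
  ipZl : forall (a : R[i]) F G, H F -> H G ->
    ip (fun x => a * F x) G = a * ip F G ;
  ip_herm : forall F G, H F -> H G -> ip G F = (ip F G)^* ;
  ip_pos : forall F, H F -> F <> 0 -> 0 < ip F F ;
  hilb_complete : forall u : nat -> X -> R[i], (forall n, H (u n)) ->
    (forall e : R, 0 < e -> exists N : nat, forall m n : nat,
      (N <= m)%N -> (N <= n)%N -> hnorm ip (u m - u n) < e) ->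
    exists2 F, H F & (fun n => hnorm ip (u n - F)) @ \oo --> (0 : R) }.

Record is_rkhs {X : Type} (K : X -> X -> R[i]) (H : set (X -> R[i]))
    (ip : (X -> R[i]) -> (X -> R[i]) -> R[i]) : Prop := IsRkhs {
  rkhs_hilbert : is_hilbert_fct H ip ;
  rkhs_kernel : forall y, H (K ^~ y) ;
  rkhs_reproducing : forall F y, H F -> ip F (K ^~ y) = F y ;
  rkhs_dense : forall F (e : R), H F -> 0 < e ->
    exists (n : nat) (y : 'I_n -> X) (c : 'I_n -> R[i]),
      hnorm ip (F - (fun x => \sum_(i < n) c i * K x (y i))) < e }.

(* The underlying set of functions of the reproducing kernel Hilbert space of
   [K]: the pair [(H, ip)], with [ip] restricted to [H], is unique, and it
   exists when [K] is positive definite. *)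
Definition rkhs {X : Type} (K : X -> X -> R[i]) : set (X -> R[i]) :=
  [set F | exists H ip, is_rkhs K H ip /\ H F].

(* [R[i]^o] carries the topology of the modulus. *)
Definition C0 (X : topologicalType) : set (X -> R[i]) :=
  [set f | continuous (f : X -> R[i]^o) /\
    forall e : R, 0 < e ->
      exists2 A : set X, compact A & forall x, ~ A x -> `|f x| < e%:C].

(* The supremum is taken in the extended reals: it is [-oo] if [X] is empty. *)
Definition sup_dist {X : Type} (f g : X -> R[i]) : \bar R :=
  ereal_sup (range (fun x => (complex.Re `|f x - g x|)%:E)).

Definition C0_universal {X : topologicalType} (K : X -> X -> R[i]) : Prop :=
  [/\ pos_def K,
      rkhs K `<=` @C0 X &
      forall g, @C0 X g -> forall e : R, 0 < e ->
        exists2 f, rkhs K f & (sup_dist f g < e%:E)%E].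

Definition exp_kernel {X : Type} (g : X -> X -> R) : X -> X -> R[i] :=
  fun x y => (expR (- g x y))%:C.

End Kernels.

(* Main.v *)
(* Fix a base point x0. Then L(x,y) = g(x,x0) + g(x0,y) - g(x,y) - g(x0,x0) is a
   positive kernel, say L(x,y) = <h x, h y>, and
   K = exp(-g) = exp(g(x0,x0)) phi(x) phi(y) exp(L(x,y)) with
   phi = exp(-g(.,x0)) = K(.,x0) > 0. The kernel exp(<.,.>) on the
   complexification of the Hilbert space of h dominates the rank one kernels
   given by its sections, also at imaginary points iz; hence the space H_K
   contains phi exp(i<h(.),z>) for every z in the real span of h(X). These
   exponentials span a unital self-adjoint algebra T of bounded continuous
   functions, which separates points when g is metrizable. If H_K is included in
   C0(X), then phi vanishes at infinity, and phi T is dense in C0(X): divide a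
   compactly supported q by phi and approximate q / phi by some p in T on a large
   compact set, keeping |p| bounded by about sup |q / phi| everywhere; this is
   harmless where phi is small.
   Conversely, if g is not metrizable at x <> y, then K(.,x) and K(.,y) are
   proportional, so that all F in H_K satisfy a F(x) = b F(y) with a, b > 0,
   whereas C0(X) separates x from y. *)
Require Import Defs.
From HB Require Import structures.
From mathcomp Require Import all_boot all_order all_algebra.
From mathcomp Require Import complex.
From mathcomp Require Import all_classical all_reals all_analysis.
From mathcomp Require Import ring lra.
Set Implicit Arguments.
Unset Strict Implicit.
Unset Printing Implicit Defensive.
Import Order.TTheory GRing.Theory Num.Theory.
Import numFieldNormedType.Exports.
Local Open Scope classical_set_scope.
Local Open Scope ring_scope.
Local Open Scope complex_scope.

(** * Positive kernels as forms on finitely supported measures *)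

Section PositiveKernels.
Context {R : realType} {X : Type}.
Local Notation C := R[i].
Implicit Types (F : X -> C) (K A B : X -> X -> C) (s r : seq (X * C)).

(** A list stands for a finitely supported measure, and its points may repeat, so that concatenation
    is addition. In the reproducing space of [K], [pairing F s] is the inner product of [F] with
    [kcomb K s]; hence the conjugated weights. *)
Definition pairing F s : C := \sum_(p <- s) conjc p.2 * F p.1.

Definition kcomb K s : X -> C := fun x => \sum_(q <- s) q.2 * K x q.1.

Definition sform K s r : C := pairing (kcomb K r) s.

Definition wscale (a : C) s := [seq (p.1, a * p.2) | p <- s].

Definition wmul F s := [seq (p.1, p.2 * F p.1) | p <- s].

Definition hermitian K := forall x y, K y x = conjc (K x y).

Definition psd K := hermitian K /\ forall s, 0 <= sform K s s.

Lemma pairing_cat F s r : pairing F (s ++ r) = pairing F s + pairing F r.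
Proof. exact: big_cat. Qed.

Lemma pairing_nil F : pairing F [::] = 0.
Proof. exact: big_nil. Qed.

Lemma pairing1 F x c : pairing F [:: (x, c)] = conjc c * F x.
Proof. exact: big_seq1. Qed.

Lemma pairing_wscale F a s : pairing F (wscale a s) = conjc a * pairing F s.
Proof.
rewrite /pairing big_map mulr_sumr; apply: eq_bigr => p _ /=.
by rewrite rmorphM /= mulrA.
Qed.

Lemma pairingD F G s : pairing (fun x => F x + G x) s = pairing F s + pairing G s.
Proof. by rewrite /pairing -big_split; apply: eq_bigr => p _; rewrite mulrDr. Qed.

Lemma pairingZ F a s : pairing (fun x => a * F x) s = a * pairing F s.
Proof. by rewrite /pairing mulr_sumr; apply: eq_bigr => p _; rewrite mulrCA. Qed.

Lemma eq_pairing F G s : F =1 G -> pairing F s = pairing G s.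
Proof. by move=> e; apply: eq_bigr => p _; rewrite e. Qed.

Lemma sformE K s r :
  sform K s r = \sum_(p <- s) \sum_(q <- r) conjc p.2 * q.2 * K p.1 q.1.
Proof.
apply: eq_bigr => p _; rewrite mulr_sumr.
by apply: eq_bigr => q _; rewrite mulrA.
Qed.

Lemma kcomb_cat K s r x : kcomb K (s ++ r) x = kcomb K s x + kcomb K r x.
Proof. exact: big_cat. Qed.

Lemma kcomb_wscale K a s x : kcomb K (wscale a s) x = a * kcomb K s x.
Proof.
rewrite /kcomb big_map mulr_sumr; apply: eq_bigr => p _ /=.
by rewrite mulrA.
Qed.

Lemma kcomb1 K x c y : kcomb K [:: (x, c)] y = c * K y x.
Proof. exact: big_seq1. Qed.

Lemma sform1 K x c y d :
  sform K [:: (x, c)] [:: (y, d)] = conjc c * (d * K x y).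
Proof. by rewrite /sform pairing1 kcomb1. Qed.

Lemma sform_catl K s s' r : sform K (s ++ s') r = sform K s r + sform K s' r.
Proof. exact: pairing_cat. Qed.

Lemma sform_catr K s r r' : sform K s (r ++ r') = sform K s r + sform K s r'.
Proof. by rewrite -pairingD; apply: eq_pairing => x; rewrite kcomb_cat. Qed.

Lemma sform_wscalel K a s r : sform K (wscale a s) r = conjc a * sform K s r.
Proof. exact: pairing_wscale. Qed.

Lemma sform_wscaler K a s r : sform K s (wscale a r) = a * sform K s r.
Proof. by rewrite -pairingZ; apply: eq_pairing => x; rewrite kcomb_wscale. Qed.

Lemma sform_herm K s r : hermitian K -> sform K r s = conjc (sform K s r).
Proof.
move=> hK; rewrite !sformE exchange_big rmorph_sum; apply: eq_bigr => p _.
rewrite rmorph_sum; apply: eq_bigr => q _.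
by rewrite !rmorphM /= conjcK -hK (mulrC (p.2)).
Qed.

Lemma sform_cat2 K s r : hermitian K ->
  sform K (s ++ r) (s ++ r) =
  sform K s s + sform K r r + (sform K r s + conjc (sform K r s)).
Proof.
move=> hK; rewrite sform_catl !sform_catr [sform K s r]sform_herm//; ring.
Qed.

Lemma sformD A B s r :
  sform (fun x y => A x y + B x y) s r = sform A s r + sform B s r.
Proof.
rewrite -pairingD; apply: eq_pairing => x; rewrite /kcomb -big_split.
by apply: eq_bigr => q _; rewrite mulrDr.
Qed.

Lemma sformZ K a s r : sform (fun x y => a * K x y) s r = a * sform K s r.
Proof.
rewrite -pairingZ; apply: eq_pairing => x; rewrite /kcomb mulr_sumr.
by apply: eq_bigr => q _; rewrite mulrCA.
Qed.

Lemma sform_wmul K F s :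
  sform (fun x y => conjc (F x) * F y * K x y) s s = sform K (wmul F s) (wmul F s).
Proof.
rewrite !sformE big_map; apply: eq_bigr => p _; rewrite big_map.
by apply: eq_bigr => q _; rewrite /= rmorphM /=; ring.
Qed.

Lemma eq_sform A B s r : A =2 B -> sform A s r = sform B s r.
Proof.
move=> e; rewrite !sformE; apply: eq_bigr => p _; apply: eq_bigr => q _.
by rewrite e.
Qed.

Lemma psdD A B : psd A -> psd B -> psd (fun x y => A x y + B x y).
Proof.
move=> [hA pA] [hB pB]; split=> [x y|s]; first by rewrite hA hB rmorphD.
by rewrite sformD addr_ge0.
Qed.

Lemma psdZ K (a : C) : 0 <= a -> psd K -> psd (fun x y => a * K x y).
Proof.
move=> a0 [hK pK]; split=> [x y|s]; last by rewrite sformZ mulr_ge0.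
by rewrite hK rmorphM /= [conjc a](CrealP _) // ger0_real.
Qed.

Lemma psd_wmul K F : psd K -> psd (fun x y => conjc (F x) * F y * K x y).
Proof.
move=> [hK pK]; split=> [x y|s]; last by rewrite sform_wmul.
by rewrite hK !rmorphM /= conjcK; ring.
Qed.

Lemma eq_psd A B : A =2 B -> psd A -> psd B.
Proof.
move=> e [hA pA]; split=> [x y|s]; first by rewrite -!e.
by rewrite -(eq_sform _ _ e).
Qed.

Lemma psd_cst1 : psd (fun _ _ => 1).
Proof.
split=> [x y|s]; first by rewrite rmorph1.
rewrite sformE; set t := \sum_(p <- s) p.2.
suff -> : \sum_(p <- s) \sum_(q <- s) conjc p.2 * q.2 * 1 = t * conjc t.
  exact: mulcJ_ge0.
rewrite rmorph_sum mulr_sumr; apply: eq_bigr => p _.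
by rewrite mulr_suml; apply: eq_bigr => q _; rewrite mulr1 mulrC.
Qed.

Lemma psd_ge0 K x : psd K -> 0 <= K x x.
Proof.
move=> [_ /(_ [:: (x, 1)])].
by rewrite sform1 conjc1 !mul1r.
Qed.

Lemma psd_kcomb K s z : hermitian K ->
  sform K s [:: (z, 1)] = conjc (kcomb K s z).
Proof.
move=> hK; by rewrite sform_herm// /sform pairing1 conjc1 mul1r.
Qed.

Lemma affine_not_ge0 (a b : R) : 0 < b ->
  ~ (forall t : R, 0 <= a + t * b).
Proof.
move=> b0 /(_ (- (`|a| + 1) / b)).
rewrite mulfVK ?gt_eqF//; have := ler_norm a; lra.
Qed.

(** Against the weight 1 at [y] and [t * K z y] at [z], the form is affine in [t] with slope
    [2 * |K z y|^2]. It can only stay nonnegative for all real [t] if this slope is zero. *)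
Lemma psd_diag0 K z y : psd K -> K z z = 0 -> K z y = 0.
Proof.
move=> [hK pK] Kzz; apply/eqP/negPn/negP => Kzy.
pose b : R := 2 * complex.Re (K z y * conjc (K z y)).
have b0 : 0 < b.
  have : 0 < K z y * conjc (K z y) by rewrite lt_def mulf_neq0 ?conjc_eq0 // mulcJ_ge0.
  by rewrite ltcE /= => /andP[_ ?]; rewrite mulr_gt0.
apply: (@affine_not_ge0 (complex.Re (K y y)) b b0) => t.
have := pK ((y, 1) :: [:: (z, t%:C * K z y)]).
rewrite sformE !big_cons !big_nil /= Kzz (hK z y) lecE /= => /andP[_].
rewrite /b; case: (K z y) => u v; case: (K y y) => u' v' /=; nra.
Qed.
End PositiveKernels.

(** * Schur products and limits of positive kernels *)

Section SchurProduct.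
Context {R : realType} {X : Type}.
Local Notation C := R[i].
Implicit Types (F : X -> C) (K A B : X -> X -> C) (s : seq (X * C)).

(** The form of the Schur complement at [s] is the form of [K] at [s] with one further mass at [z],
    chosen to minimise it. *)
Lemma psd_schur_compl K z : psd K ->
  psd (fun x y => K x y - (K z z)^-1 * (K x z * K z y)).
Proof.
move=> psdK; have [hK pK] := psdK.
have Kzz : conjc (K z z) = K z z by rewrite -hK.
have hK' : hermitian (fun x y => K x y - (K z z)^-1 * (K x z * K z y)).
  by move=> x y; rewrite !rmorphB !rmorphM fmorphV /= Kzz -!hK; ring.
(* If [K z z = 0] its inverse is 0 by convention, and the complement is [K] itself. *)
split=> // s; have [Kz0|Kz0] := eqVneq (K z z) 0.
  have /(eq_sform s s) -> : (fun x y => K x y - (K z z)^-1 * (K x z * K z y)) =2 K.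
    by move=> x y; rewrite Kz0 invr0 mul0r subr0.
  exact: pK.
set u := kcomb K s z.
have -> : sform (fun x y => K x y - (K z z)^-1 * (K x z * K z y)) s s =
    sform K s s - (K z z)^-1 * (conjc u * u).
  rewrite /sform (@eq_pairing _ _ _
      (fun x => kcomb K s x + - (K z z)^-1 * (u * K x z))); last first.
    move=> x; rewrite /u /kcomb mulr_suml mulr_sumr -big_split.
    by apply: eq_bigr => q _ /=; ring.
  rewrite pairingD pairingZ pairingZ mulNr; congr (_ - _ * _).
  rewrite mulrC; congr (_ * _).
  have := psd_kcomb s z hK; rewrite -/u sformE => <-; apply: eq_bigr => p _.
  by rewrite big_seq1 mulr1.
have := pK (s ++ [:: (z, - (K z z)^-1 * u)]); rewrite sform_cat2//.
suff -> : sform K s s + sform K [:: (z, - (K z z)^-1 * u)] [:: (z, - (K z z)^-1 * u)] +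
   (sform K [:: (z, - (K z z)^-1 * u)] s +
    conjc (sform K [:: (z, - (K z z)^-1 * u)] s)) =
  sform K s s - (K z z)^-1 * (conjc u * u) by [].
rewrite sform1 /sform pairing1 -/u.
rewrite !rmorphM !rmorphN !fmorphV /= !conjcK Kzz.
by field.
Qed.

(** Schur product theorem, by induction on the list for all [A] at once. The Schur complement of [A]
    at the head [z] vanishes on the row and column of [z], so that its product with [B] only sees
    the tail; the rank one remainder merely reweights [B]. *)
Lemma psdM A B : psd A -> psd B -> psd (fun x y => A x y * B x y).
Proof.
move=> + pB; have [hB _] := pB => pA.
split=> [x y|s]; first by have [hA _] := pA; rewrite hA hB rmorphM.
elim: s A pA => [|[z c] s IH] A pA.
  by rewrite /sform pairing_nil.
pose A' x y := A x y - (A z z)^-1 * (A x z * A z y).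
have pA' : psd A' by exact: psd_schur_compl.
have A'l y : A' z y = 0.
  rewrite /A'; have [Az0|Az0] := eqVneq (A z z) 0.
    by rewrite (psd_diag0 y pA Az0) !mulr0 subr0.
  by rewrite mulKf// subrr.
have A'r y : A' y z = 0.
  by have [-> _] := pA'; rewrite A'l rmorph0.
have -> : sform (fun x y => A x y * B x y) ((z, c) :: s) ((z, c) :: s) =
    sform (fun x y => A' x y * B x y) ((z, c) :: s) ((z, c) :: s) +
    sform (fun x y => (A z z)^-1 * (conjc (A z x) * A z y * B x y))
       ((z, c) :: s) ((z, c) :: s).
  rewrite -sformD; apply: eq_sform => x y.
  by have [hA _] := pA; rewrite /A' (hA z x); ring.
apply: addr_ge0; last first.
  rewrite sformZ (sform_wmul B (A z)).
  apply: mulr_ge0; first by rewrite invr_ge0; exact: psd_ge0.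
  by have [_] := pB; apply.
have -> : sform (fun x y => A' x y * B x y) ((z, c) :: s) ((z, c) :: s) =
    sform (fun x y => A' x y * B x y) s s.
  rewrite !sformE big_cons big1 ?add0r => [|q _].
    apply: eq_bigr => p _.
    by rewrite big_cons/= A'r mul0r mulr0 add0r.
  by rewrite A'l mul0r mulr0.
exact: IH.
Qed.

(** Removing the constant 1 gives a stronger statement, which survives in the limit as positivity of
    [cexp (P x y) - 1]. *)
Lemma psd_exp1Dsub1 A (a : C) n : 0 <= a -> psd A ->
  psd (fun x y => (1 + a * A x y) ^+ n - 1).
Proof.
move=> a0 pA; elim: n => [|n IH].
  apply: (eq_psd _ (psdZ (lexx 0) pA)) => x y.
  by rewrite mul0r expr0 subrr.
apply: (eq_psd _ (psdD IH (psdZ a0 (psdD pA (psdM pA IH))))) => x y.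
by rewrite exprS; ring.
Qed.

(** Hermitian symmetry and each form, a finite sum of values, pass to the limit. Real and imaginary
    parts are kept apart so that all limits are taken in [R]. *)
Lemma psd_limit (A : nat -> X -> X -> C) B : (forall n, psd (A n)) ->
  (forall x y, (fun n => complex.Re (A n x y)) @ \oo --> complex.Re (B x y)) ->
  (forall x y, (fun n => complex.Im (A n x y)) @ \oo --> complex.Im (B x y)) ->
  psd B.
Proof.
move=> pA cRe cIm.
have hB : hermitian B.
  move=> x y; apply/eqP; rewrite eq_complex; apply/andP; split; apply/eqP.
    apply: (cvg_unique (@Rhausdorff R) (cRe y x)).
    rewrite (_ : (fun n => _) = (fun n => complex.Re (A n x y))).
      by case: (B x y) (cRe x y).
    by apply/funext => n; have [-> _] := pA n; case: (A n x y).
  apply: (cvg_unique (@Rhausdorff R) (cIm y x)).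
  rewrite (_ : (fun n => _) = (fun n => - complex.Im (A n x y))).
    have -> : complex.Im (conjc (B x y)) = - complex.Im (B x y) by case: (B x y).
    exact: cvgN.
  by apply/funext => n; have [-> _] := pA n; case: (A n x y).
split=> // s.
have rQ : complex.Im (sform B s s) = 0.
  by have := sform_herm s s hB; case: (sform B s s) => u v [] /=; lra.
rewrite lecE rQ eqxx /=.
have ReE K : complex.Re (sform K s s) = \sum_(p <- s) \sum_(q <- s)
   (complex.Re (conjc p.2 * q.2) * complex.Re (K p.1 q.1)
    - complex.Im (conjc p.2 * q.2) * complex.Im (K p.1 q.1)).
  rewrite sformE (raddf_sum (@complex.Re R : Rcomplex R -> R)).
  apply: eq_bigr => p _.
  rewrite (raddf_sum (@complex.Re R : Rcomplex R -> R)).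
  apply: eq_bigr => q _.
  by case: (conjc _ * _) => u v; case: (K _ _).
apply: (@cvgr_to_ge nat \oo _ R (fun n => complex.Re (sform (A n) s s))); last first.
  by apply: nearW => n; have [_ /(_ s)] := pA n; rewrite lecE => /andP[].
under eq_fun do rewrite ReE.
rewrite ReE; apply: (cvg_big (@add_continuous R)) => p _.
apply: (cvg_big (@add_continuous R)) => q _.
by apply: cvgB; apply: cvgMr.
Qed.
End SchurProduct.

(** * The complex exponential *)

Section ComplexExponential.
Context {R : realType}.
Local Notation C := R[i].

Definition expi (t : R) : C := cos t +i* sin t.

Definition cexp (z : C) : C := (expR (complex.Re z))%:C * expi (complex.Im z).

Lemma expiD s t : expi (s + t) = expi s * expi t.
Proof. by rewrite /expi cosD sinD; simpc; rewrite (addrC (sin s * _)). Qed.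

Lemma expi0 : expi 0 = 1.
Proof. by rewrite /expi cos0 sin0. Qed.

Lemma expiN t : expi (- t) = conjc (expi t).
Proof. by rewrite /expi cosN sinN. Qed.

Lemma cexpD z w : cexp (z + w) = cexp z * cexp w.
Proof.
rewrite /cexp (raddfD (@complex.Re R : Rcomplex R -> R)) expRD.
rewrite (raddfD (@complex.Im R : Rcomplex R -> R)) expiD rmorphM /=; ring.
Qed.

Lemma cexp0 : cexp 0 = 1.
Proof. by rewrite /cexp expi0 expR0 mulr1. Qed.

Lemma cexp_real (a : R) : cexp a%:C = (expR a)%:C.
Proof. by rewrite /cexp /= expi0 mulr1. Qed.

Lemma cexpMn z n : cexp (n%:R * z) = cexp z ^+ n.
Proof.
elim: n => [|n IH]; first by rewrite mul0r cexp0 expr0.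
by rewrite exprS -IH -cexpD -natr1 mulrDl mul1r addrC.
Qed.

Lemma conjcZ (t : R) (z : C) : conjc (t%:C * z) = t%:C * conjc z.
Proof. by case: z => u v; simpc. Qed.

Lemma norm_Re_le (z : C) : `|complex.Re z| <= complex.Re `|z|.
Proof.
case: z => a b /=; rewrite -sqrtr_sqr ler_wsqrtr// lerDl; exact: sqr_ge0.
Qed.

Lemma norm_Im_le (z : C) : `|complex.Im z| <= complex.Re `|z|.
Proof.
case: z => a b /=; rewrite -sqrtr_sqr ler_wsqrtr// lerDr; exact: sqr_ge0.
Qed.

Lemma norm_le_ReIm (z : C) :
  complex.Re `|z| <= `|complex.Re z| + `|complex.Im z|.
Proof.
case: z => a b /=; rewrite -[leRHS]ger0_norm ?addr_ge0// -sqrtr_sqr.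
rewrite ler_wsqrtr// sqrrD !real_normK ?num_real//.
by have : 0 <= `|a| * `|b|; [exact: mulr_ge0 | lra].
Qed.

Lemma normE (z : C) : `|z| = (complex.Re `|z|)%:C.
Proof. by case: z. Qed.

Lemma Re_norm_gt0 (z : C) : z != 0 -> 0 < complex.Re `|z|.
Proof. by rewrite -normr_gt0 normE ltcR. Qed.

Lemma normcexp z : `|cexp z| = (expR (complex.Re z))%:C.
Proof.
rewrite normrM normc_def /= expr0n addr0 sqrtr_sqr ger0_norm ?expR_ge0//.
by rewrite normc_def /= cos2Dsin2 sqrtr1 mulr1.
Qed.

Lemma cvgn_slope (f : R -> R) (d : R) : is_derive (0 : R) (1 : R) f d ->
  (fun n => n.+1%:R * (f n.+1%:R^-1 - f 0)) @ \oo --> d.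
Proof.
move=> [df <-].
have /cvg_dnbhs_at_right/cvg_at_rightP := df.
move=> /(_ (fun n => n.+1%:R^-1)) H.
apply: cvg_trans (H _); last by split=> [n|]; [rewrite invr_gt0|exact: cvg_harmonic].
apply: near_eq_cvg; apply: nearW => n /=.
by rewrite invrK addr0 -[_ *: 1]/(_ * 1) mulr1.
Qed.

(** Telescoping of the difference of powers. Since [1 <= M], the exponent [n] may replace the sharp
    [n - 1]. *)
Lemma distXn_le (x y M : C) n : `|x| <= M -> `|y| <= M -> 1 <= M ->
  `|x ^+ n - y ^+ n| <= n%:R * M ^+ n * `|x - y|.
Proof.
move=> xM yM M1; have M0 : 0 <= M by exact: le_trans M1.
elim: n => [|n IH]; first by rewrite subrr normr0 !mul0r.
have -> : x ^+ n.+1 - y ^+ n.+1 = x * (x ^+ n - y ^+ n) + (x - y) * y ^+ n.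
  by rewrite !exprS; ring.
apply: (le_trans (ler_normD _ _)); rewrite !normrM normrX.
have h1 : `|x| * `|x ^+ n - y ^+ n| <= n%:R * M ^+ n.+1 * `|x - y|.
  by rewrite exprS mulrCA -mulrA; apply: ler_pM => //; rewrite mulrA.
have h2 : `|x - y| * `|y| ^+ n <= M ^+ n.+1 * `|x - y|.
  rewrite mulrC; apply: ler_wpM2r => //.
  apply: (@le_trans _ _ (M ^+ n)); first by rewrite lerXn2r ?nnegrE.
  by rewrite exprS ler_peMl ?exprn_ge0.
by apply: (le_trans (lerD h1 h2)); rewrite -natr1 !mulrDl mul1r.
Qed.

(** The first order Taylor error of the exponential at [z / (n + 1)]; the derivatives at 0 show that
    [n + 1] times this error tends to 0. *)
Let e (z : C) (n : nat) := cexp (n.+1%:R^-1%:C * z) - (1 + n.+1%:R^-1%:C * z).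

Let cvg_Re (z : C) : (fun n => n.+1%:R * complex.Re (e z n)) @ \oo --> (0 : R).
Proof.
case: z => a b.
pose f (h : R) := expR (h * a) * cos (h * b) - h * a.
have /cvgn_slope : is_derive (0 : R) (1 : R) f 0.
  rewrite /f; apply: is_derive_eq.
  rewrite !mul0r ?scaler0 ?scale0r /= expR0 cos0 sin0 /GRing.scale /=; ring.
rewrite /f !mul0r expR0 cos0 subr0 mulr1; apply: cvg_trans.
apply: near_eq_cvg; apply: nearW => n /=.
congr (_ * _); rewrite /e /cexp /expi; simpc => /=; ring.
Qed.

Let cvg_Im (z : C) : (fun n => n.+1%:R * complex.Im (e z n)) @ \oo --> (0 : R).
Proof.
case: z => a b.
pose f (h : R) := expR (h * a) * sin (h * b) - h * b.
have /cvgn_slope : is_derive (0 : R) (1 : R) f 0.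
  rewrite /f; apply: is_derive_eq.
  rewrite !mul0r ?scaler0 ?scale0r /= expR0 cos0 sin0 /GRing.scale /=; ring.
rewrite /f !mul0r expR0 sin0 !mulr0 !subr0; apply: cvg_trans.
apply: near_eq_cvg; apply: nearW => n /=.
congr (_ * _); rewrite /e /cexp /expi; simpc => /=; ring.
Qed.

Let cvg_e (z : C) :
  (fun n => n.+1%:R * complex.Re `|e z n|) @ \oo --> (0 : R).
Proof.
apply: (@squeeze_cvgr _ \oo _ _ (fun=> 0) (fun n =>
  `|n.+1%:R * complex.Re (e z n)| + `|n.+1%:R * complex.Im (e z n)|)).
- apply: nearW => n /=; rewrite mulr_ge0 ?(le_trans _ (norm_Re_le _))//=.
  rewrite !normrM ger0_norm// -mulrDr ler_wpM2l//; exact: norm_le_ReIm.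
- exact: cvg_cst.
- rewrite -[in X in _ --> X](addr0 (0 : R)) -(normr0 R).
  by apply: cvgD; apply: cvg_norm; [exact: cvg_Re|exact: cvg_Im].
Qed.

(** As [cexp z] is the power [n + 1] of [cexp (z / (n + 1))], two powers are to be compared. Both
    bases are bounded by [M = exp (|z| / (n + 1))], whose power is [exp |z|] for all [n]. *)
Lemma cvg_cexp_pow z :
  (fun n => complex.Re `|cexp z - (1 + n.+1%:R^-1%:C * z) ^+ n.+1|) @ \oo --> (0 : R).
Proof.
set r := complex.Re `|z|.
have r0 : 0 <= r by rewrite (le_trans _ (norm_Re_le _)).
apply: (@squeeze_cvgr _ \oo _ _ (fun=> 0)
  (fun n => expR r * (n.+1%:R * complex.Re `|e z n|))); last first.
- by rewrite -(mulr0 (expR r)); apply: cvgMl_tmp; exact: cvg_e.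
- exact: cvg_cst.
apply: nearW => n /=; rewrite (le_trans _ (norm_Re_le _))//=.
pose q : R := n.+1%:R^-1.
have q0 : 0 <= q by rewrite invr_ge0.
have nq : n.+1%:R * q = 1 by rewrite mulfV.
have nqC : n.+1%:R * q%:C = 1 :> C.
  by rewrite -(rmorph_nat (real_complex R)) -rmorphM nq.
pose M : C := (expR (q * r))%:C.
have MX : M ^+ n.+1 = (expR r)%:C.
  by rewrite -rmorphXn /= -expRM_natl mulrA nq mul1r.
have := @distXn_le (cexp (q%:C * z)) (1 + q%:C * z) M n.+1.
rewrite MX -cexpMn mulrA nqC mul1r.
rewrite -/(e z n) [`|e z n|]normE [`|_ - _ ^+ _|]normE.
rewrite -(rmorph_nat (real_complex R) n.+1) -!rmorphM.
have -> : n.+1%:R * expR r * complex.Re `|e z n| = expR r * (n.+1%:R * complex.Re `|e z n|).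
  by rewrite mulrA (mulrC (expR r)).
rewrite -lecR; apply.
- rewrite normcexp lecR ler_expR.
  have -> : complex.Re (q%:C * z) = q * complex.Re z.
    by case: z {r r0 M MX} => a b /=; rewrite mul0r subr0.
  by rewrite ler_wpM2l// (le_trans (ler_norm _) (norm_Re_le _)).
- apply: (le_trans (ler_normD _ _)); rewrite normr1 normrM normE [`|z|]normE.
  rewrite -[1]/(1%:C) -rmorphM -rmorphD lecR /= expr0n addr0 sqrtr_sqr ger0_norm//.
  exact: expR_ge1Dx.
- by rewrite -[1]/(1%:C) lecR -expR0 ler_expR mulr_ge0.
Qed.
End ComplexExponential.

(** * Exponentials of positive kernels *)

Section ExponentialKernels.
Context {R : realType} {X : Type}.
Local Notation C := R[i].
Implicit Types (K L P : X -> X -> C) (w s : seq (X * C)).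

Lemma psd_cexp_sub1 P : psd P -> psd (fun x y => cexp (P x y) - 1).
Proof.
move=> pP.
pose A n x y := (1 + n.+1%:R^-1%:C * P x y) ^+ n.+1 - 1.
have A_P x y :
  (fun n => complex.Re `|cexp (P x y) - 1 - A n x y|) @ \oo --> (0 : R).
  rewrite /A; under eq_fun do rewrite opprB addrA subrK.
  exact: cvg_cexp_pow.
apply: (@psd_limit _ _ A) => [n|x y|x y].
- by apply: psd_exp1Dsub1 => //; rewrite ler0c invr_ge0.
- apply/subr_cvg0/norm_cvg0P.
  apply: (@squeeze_cvgr _ \oo _ _ (fun=> 0) _ _ _ _ _ (A_P x y)); last exact: cvg_cst.
  apply: nearW => n; rewrite normr_ge0 andTb distrC.
  by rewrite -(raddfB (@complex.Re R : Rcomplex R -> R)) (norm_Re_le _).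
- apply/subr_cvg0/norm_cvg0P.
  apply: (@squeeze_cvgr _ \oo _ _ (fun=> 0) _ _ _ _ _ (A_P x y)); last exact: cvg_cst.
  apply: nearW => n; rewrite normr_ge0 andTb distrC.
  by rewrite -(raddfB (@complex.Im R : Rcomplex R -> R)) (norm_Im_le _).
Qed.

Lemma psd_cexp P : psd P -> psd (fun x y => cexp (P x y)).
Proof.
move=> pP; apply: (eq_psd _ (psdD (psd_cexp_sub1 pP) psd_cst1)) => x y.
by rewrite subrK.
Qed.

Lemma conj_cexp (z : C) : conjc (cexp z) = cexp (conjc z).
Proof.
case: z => a b; rewrite [LHS]rmorphM; congr (_ * _); last exact: esym (expiN _).
exact: conjc_real.
Qed.

(* If [L x y] is the inner product of [h x] and [h y], this is the inner product
   of [h x + W] and [h y + W], where [W] is the combination [w] of values of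
   [h]. *)
Lemma psd_translate L w : psd L ->
  psd (fun x y => sform L ((x, 1) :: w) ((y, 1) :: w)).
Proof.
move=> [hL pL]; split=> [x y|s]; first exact: sform_herm.
(* With [T] the total mass of [s], the translated form at [s] is the form of [L] at the measure
   [s + T w]. *)
have -> : sform (fun x y => sform L ((x, 1) :: w) ((y, 1) :: w)) s s =
    sform L (s ++ wscale (\sum_(p <- s) p.2) w) (s ++ wscale (\sum_(p <- s) p.2) w).
  set T := \sum_(p <- s) p.2.
  have kE y : \sum_(q <- s) q.2 * sform L ((y, 1) :: w) ((q.1, 1) :: w) =
      kcomb L (s ++ wscale T w) y + sform L w (s ++ wscale T w).
    transitivity (\sum_(q <- s) (q.2 * L y q.1 + q.2 * kcomb L w y
        + (q.2 * pairing (L^~ q.1) w + q.2 * sform L w w))).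
      apply: eq_bigr => q _.
      rewrite -cat1s -(cat1s (q.1, 1)) sform_catl !sform_catr sform1 /sform.
      rewrite pairing1 conjc1 !mul1r !mulrDr; congr (_ + _ + (_ * _ + _)).
      by apply: eq_pairing => x; rewrite kcomb1 mul1r.
    rewrite !big_split /= -!mulr_suml -/T kcomb_cat kcomb_wscale.
    rewrite sform_catr sform_wscaler; congr (_ + _ + (_ + _)).
    rewrite sformE exchange_big; apply: eq_bigr => q _.
    by rewrite mulr_sumr; apply: eq_bigr => p _; rewrite mulrCA mulrA.
  rewrite {1}/sform (eq_pairing _ kE) (pairingD (kcomb L (s ++ wscale T w))).
  rewrite [RHS]sform_catl sform_wscalel; congr (_ + _).
  by rewrite /pairing -mulr_suml /T rmorph_sum.
exact: pL.
Qed.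

(** Write [L x y = <h x, h y>] and let [W] be the combination [w] of values of [h]. The kernel
    [exp <h x - W, h y - W> - 1] is positive, and reweighting it by the exponentials of [<h x, W>]
    gives the claim. *)
Lemma psd_cexp_dominates L w : psd L ->
  psd (fun x y => cexp (sform L w w) * cexp (L x y)
                  - cexp (kcomb L w x) * conjc (cexp (kcomb L w y))).
Proof.
move=> pL; have [hL _] := pL.
pose w' := wscale (-1) w.
apply: (eq_psd _ (psd_wmul (fun y => conjc (cexp (kcomb L w y)))
   (psd_cexp_sub1 (psd_translate w' pL)))) => x y.
rewrite conjcK mulrBr mulr1; congr (_ - _).
rewrite conj_cexp -!cexpD; congr (cexp _).
rewrite -cat1s -(cat1s (y, 1)) sform_catl !sform_catr sform1.
rewrite /w' sform_wscaler !sform_wscalel sform_wscaler psd_kcomb//.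
rewrite [sform L [:: (x, 1)] w]/sform pairing1 conjc1.
have -> : conjc (-1) = -1 :> C by rewrite rmorphN rmorph1.
ring.
Qed.
End ExponentialKernels.

(** * Conditionally negative definite kernels and their positive base kernels *)

Section ConditionallyNegativeKernels.
Context {R : realType} {X : choiceType}.
Local Notation C := R[i].
Implicit Types (g k : X -> X -> R).

Lemma sum_undup (s : seq (X * R)) (f : X -> R) :
  \sum_(p <- s) p.2 * f p.1 =
  \sum_(x <- undup (map fst s)) (\sum_(p <- s | p.1 == x) p.2) * f x.
Proof.
under [RHS]eq_bigr do rewrite mulr_suml.
rewrite (exchange_big_dep predT)//= big_seq [RHS]big_seq.
apply: eq_bigr => p ps.
rewrite big_mkcond (bigD1_seq p.1) ?undup_uniq ?mem_undup ?map_f//= eqxx.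
by rewrite big1 ?addr0// => x /negPf; rewrite eq_sym => ->.
Qed.

(** Positivity is tested here on lists with repetitions, whereas [cond_neg_def] speaks of distinct
    points: the weights of equal points are merged first. *)
Lemma cnd_seq g (s : seq (X * R)) : cond_neg_def g -> \sum_(p <- s) p.2 = 0 ->
  \sum_(p <- s) \sum_(q <- s) p.2 * q.2 * g p.1 q.1 <= 0.
Proof.
move=> [_ ng] s0; pose u := undup (map fst s).
pose c x := \sum_(p <- s | p.1 == x) p.2.
have -> : \sum_(p <- s) \sum_(q <- s) p.2 * q.2 * g p.1 q.1 =
    \sum_(x <- u) \sum_(y <- u) c x * c y * g x y.
  transitivity (\sum_(p <- s) p.2 * \sum_(y <- u) c y * g p.1 y).
    apply: eq_bigr => p _; rewrite -sum_undup mulr_sumr.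
    by apply: eq_bigr => q _; rewrite mulrA.
  rewrite (sum_undup s (fun x => \sum_(y <- u) c y * g x y)).
  apply: eq_bigr => x _; rewrite mulr_sumr.
  by apply: eq_bigr => y _; rewrite mulrA.
rewrite big_tnth; under eq_bigr do rewrite big_tnth.
apply: ng; first by apply/tuple_uniqP; exact: undup_uniq.
rewrite -(big_tnth _ _ u predT c) -[RHS]s0.
under [RHS]eq_bigr do rewrite -[_.2]mulr1.
by rewrite (sum_undup s (fun=> 1)); apply: eq_bigr => x _; rewrite mulr1.
Qed.

(** For a real symmetric kernel, the form at complex weights is the sum of the forms at their real
    parts and at their imaginary parts. *)
Lemma psd_real_sym k : (forall x y, k x y = k y x) ->
  (forall s : seq (X * R), 0 <= \sum_(p <- s) \sum_(q <- s) p.2 * q.2 * k p.1 q.1) ->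
  psd (fun x y => (k x y)%:C).
Proof.
move=> ksym k0.
have hk : hermitian (fun x y => (k x y)%:C) by move=> x y; rewrite conjc_real ksym.
split=> // s; rewrite lecE; apply/andP; split.
  apply/eqP; have := sform_herm s s hk.
  by case: (sform _ s s) => u v [] /=; lra.
rewrite sformE (raddf_sum (@complex.Re R : Rcomplex R -> R)).
have := addr_ge0 (k0 [seq (p.1, complex.Re p.2) | p <- s])
                 (k0 [seq (p.1, complex.Im p.2) | p <- s]).
rewrite !big_map -big_split; set a := \sum_(_ <- _) _; set b := \sum_(_ <- _) _.
suff -> : a = b by [].
apply: eq_bigr => p _; rewrite !big_map -big_split /=.
rewrite (raddf_sum (@complex.Re R : Rcomplex R -> R)).
by apply: eq_bigr => q _; case: (p.2) => ? ?; case: (q.2) => ? ? /=; ring.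
Qed.

(** If [g x y = |h x - h y|^2 + f x + f y], this is twice the inner product of [h x - h x0] and
    [h y - h x0]. *)
Definition cnd_base g x0 x y := g x x0 + g x0 y - g x y - g x0 x0.

(** A mass [- T] at [x0] brings the total mass to zero; the form of [g] at the completed list is
    then the opposite of the form of [cnd_base] at [s]. *)
Lemma psd_cnd_base g x0 : cond_neg_def g ->
  psd (fun x y => (cnd_base g x0 x y)%:C).
Proof.
move=> ng; have [gsym _] := ng; apply: psd_real_sym => [x y|s].
  by rewrite /cnd_base (gsym y x0) (gsym x0 x) (gsym y x); ring.
pose T := \sum_(p <- s) p.2.
pose G := \sum_(p <- s) p.2 * g p.1 x0.
have := @cnd_seq _ (s ++ [:: (x0, - T)]) ng.
rewrite big_cat big_seq1 /= -/T subrr => /(_ erefl).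
rewrite big_cat big_seq1 big_cat big_seq1 /=.
under eq_bigr do rewrite big_cat big_seq1 /=.
have sumT (f : X -> R) a : \sum_(p <- s) p.2 * a * f p.1 = a * \sum_(p <- s) p.2 * f p.1.
  by rewrite mulr_sumr; apply: eq_bigr => p _; ring.
rewrite big_split /= (sumT (g^~ x0)) -/G.
have -> : \sum_(i <- s) - T * i.2 * g x0 i.1 = - T * G.
  by rewrite mulr_sumr; apply: eq_bigr => p _; rewrite gsym; ring.
have -> : \sum_(p <- s) \sum_(q <- s) p.2 * q.2 * cnd_base g x0 p.1 q.1 =
    T * G + T * G - \sum_(p <- s) \sum_(q <- s) p.2 * q.2 * g p.1 q.1 - T * T * g x0 x0.
  transitivity (\sum_(p <- s) (T * (p.2 * g p.1 x0) + p.2 * G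
      - \sum_(q <- s) p.2 * q.2 * g p.1 q.1 - p.2 * (T * g x0 x0))).
    apply: eq_bigr => p _; rewrite mulr_suml mulr_suml !mulr_sumr -big_split /= -!sumrB.
    by apply: eq_bigr => q _; rewrite /cnd_base (gsym x0 q.1); ring.
  by rewrite !sumrB big_split /= -mulr_sumr -!mulr_suml -/T -/G mulrA.
lra.
Qed.
End ConditionallyNegativeKernels.

(** * Inner products from the parallelogram law *)

Section JordanVonNeumann.
Context {R : realType} {X : Type}.
Local Notation C := R[i].
Implicit Types F G : X -> C.

(** The additive function [g a = f a - a * f 1] vanishes at 1, so it has period 1 and inherits a
    bound on all [a >= 0]. Since [g (n a) = n g a], a bounded [g] must be zero. *)
Lemma additive_locally_bounded (f : R -> R) (c : R) :
  {morph f : a b / a + b} -> (forall a, 0 <= a <= 1 -> `|f a| <= c) ->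
  forall a, f a = a * f 1.
Proof.
move=> fD fc; pose g a := f a - a * f 1; pose c' := c + `|f 1|.
have f0 : f 0 = 0 by have := fD 0 0; rewrite addr0; lra.
have gD a b : g (a + b) = g a + g b by rewrite /g fD; ring.
have gc n : forall a, 0 <= a <= n%:R -> `|g a| <= c'.
  elim: n => [|n IH] a.
    move=> /andP[a0]; rewrite -(lerD2l (- a)) => a0'.
    have -> : a = 0 by apply/eqP; rewrite eq_le a0 andbT; move: a0'; lra.
    rewrite /g f0 mul0r subrr normr0 addr_ge0//.
    by apply: le_trans (fc 0 _); rewrite // lexx ler01.
  case: (leP a 1) => [a1 /andP[a0 _]|a1 /andP[a0 an]].
    rewrite (le_trans (ler_normB _ _))// lerD ?fc ?a0// normrM ger0_norm//.
    exact: ler_piMl.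
  rewrite (_ : g a = g (a - 1)); last first.
    by rewrite -[in LHS](subrK 1 a) gD {2}/g mul1r subrr addr0.
  by apply: IH; rewrite subr_ge0 (ltW a1) lerBlDr natr1.
have g0 a : 0 <= a -> g a = 0.
  move=> a0; apply/eqP/negPn/negP => ga.
  have gn n : g (n%:R * a) = n%:R * g a.
    elim: n => [|n IH]; first by rewrite !mul0r /g f0 mul0r subrr.
    by rewrite -natr1 !mulrDl !mul1r gD IH.
  pose n := Num.truncn (c' / `|g a|).
  have : `|g (n.+1%:R * a)| <= c'.
    have na0 : 0 <= n.+1%:R * a by rewrite mulr_ge0.
    apply: (gc (Num.truncn (n.+1%:R * a)).+1).
    by rewrite na0 ltW// truncnS_gt.
  by rewrite gn normrM ger0_norm// leNgt -ltr_pdivrMr ?normr_gt0// truncnS_gt.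
move=> a; have : g a = 0.
  have [/g0//|/ltW a0] := leP 0 a.
  have := gD a (- a); rewrite (g0 (- a)) ?oppr_ge0// addr0 => <-.
  by rewrite subrr /g f0 mul0r subrr.
by rewrite /g; lra.
Qed.

Definition polarized (N : (X -> C) -> R) F G : R := (N (F + G) - N (F - G)) / 4.

(** [polarized] is the real part of the inner product with squared norm [N]. The product is
    conjugate linear in its second argument, so its imaginary part is the real part of the product
    of [F] with ['i * G]. *)
Definition polarized_ip (N : (X -> C) -> R) F G : C :=
  polarized N F G +i* polarized N F (fun x => 'i * G x).

Context (H : set (X -> C)) (N : (X -> C) -> R).
Hypothesis HD : forall F G, H F -> H G -> H (F + G).
Hypothesis HZ : forall (a : C) F, H F -> H (fun x => a * F x).
Hypothesis N_ge0 : forall F, H F -> 0 <= N F.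
Hypothesis NZ : forall (a : C) F, H F ->
  N (fun x => a * F x) = complex.Re `|a| ^+ 2 * N F.
Hypothesis parallelogram : forall F G, H F -> H G ->
  N (F + G) + N (F - G) = 2 * N F + 2 * N G.

Local Notation B := (polarized N).
Local Notation "a *' F" := (fun x => a * F x) (at level 40).

Let HN F : H F -> H (- F).
Proof.
move=> /(HZ (-1)); congr H; apply/funext => x /=; exact: mulN1r.
Qed.

Let HB F G : H F -> H G -> H (F - G).
Proof. by move=> hF hG; apply: HD => //; exact: HN. Qed.

Let NN F : H F -> N (- F) = N F.
Proof.
move=> hF; have -> : - F = (-1) *' F by apply/funext => x; rewrite mulN1r.
by rewrite NZ// normrN1 expr1n mul1r.
Qed.

(** Half of a signed sum of three parallelogram laws. Replacing [G] by [- G] affects only the first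
    two terms on the right, whence the additivity of [polarized]. *)
Let Nsum3 F F' G : H F -> H F' -> H G ->
  N (F + F' + G) = N (F + G) + N (F' + G) + N F + N F' - N G - N (F - F').
Proof.
move=> hF hF' hG.
have := parallelogram (HD hF hG) hF'.
have := parallelogram (HD hF' hG) hF.
have := parallelogram hG (HB hF hF').
have -> : F + G + F' = F + F' + G by rewrite addrAC.
have -> : F' + G + F = F + F' + G by rewrite addrC addrA.
have -> : F + G - F' = G + (F - F') by rewrite addrAC addrC.
have -> : F' + G - F = G - (F - F') by rewrite opprB addrA (addrC G).
lra.
Qed.

Lemma polarizedDl F F' G : H F -> H F' -> H G -> B (F + F') G = B F G + B F' G.
Proof.
move=> hF hF' hG; rewrite /polarized (Nsum3 hF hF' hG) (Nsum3 hF hF' (HN hG)).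
by rewrite NN//; field.
Qed.

Lemma polarizedC F G : H F -> H G -> B F G = B G F.
Proof.
by move=> hF hG; rewrite /polarized (addrC F G) -(NN (HB hF hG)) opprB.
Qed.

Lemma polarizedNl F G : H F -> H G -> B (- F) G = - B F G.
Proof.
move=> hF hG; rewrite /polarized -(NN (HD (HN hF) hG)) -(NN (HB (HN hF) hG)).
by rewrite !opprD !opprK; lra.
Qed.

(** Additivity in the scalar is upgraded to linearity by boundedness for scalars in [0, 1]; the
    bound comes from the parallelogram law. *)
Lemma polarizedZl (t : R) F G : H F -> H G -> B (t%:C *' F) G = t * B F G.
Proof.
move=> hF hG.
have tF (a : R) : H (a%:C *' F) by exact: HZ.
have -> := @additive_locally_bounded (fun a => B (a%:C *' F) G)
  ((2 * N F + 2 * N G) / 4).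
- congr (_ * B _ _); apply/funext => x; exact: mul1r.
- move=> a b /=; rewrite -polarizedDl//; congr B; apply/funext => x.
  by rewrite rmorphD mulrDl.
move=> a /andP[a0 a1]; rewrite /polarized normrM [`|_^-1|]ger0_norm ?invr_ge0//.
rewrite ler_pM2r ?invr_gt0//.
apply: (le_trans (ler_normB _ _)).
rewrite !ger0_norm ?N_ge0 ?parallelogram//; [|exact: HB|exact: HD].
rewrite lerD2r ler_pM2l// NZ//= expr0n addr0 sqrtr_sqr ger0_norm//.
by rewrite ler_piMl ?N_ge0// expr_le1.
Qed.

Let iF F : H F -> H ('i *' F). Proof. exact: HZ. Qed.

Let Ni F : H F -> N ('i *' F) = N F.
Proof.
move=> hF; rewrite NZ//= expr0n expr1n add0r sqrtr1 expr1n; exact: mul1r.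
Qed.

Let polarized_ii F G : H F -> H G -> B ('i *' F) ('i *' G) = B F G.
Proof.
move=> hF hG; rewrite /polarized -(Ni (HD hF hG)) -(Ni (HB hF hG)).
congr ((N _ - N _) / _); apply/funext => x; first by rewrite -mulrDr.
by rewrite -mulrBr.
Qed.

Let polarized_il F G : H F -> H G -> B ('i *' F) G = - B F ('i *' G).
Proof.
move=> hF hG; rewrite -(polarized_ii (iF hF) hG) -(polarizedNl hF (iF hG)).
by congr B; apply/funext => x; rewrite mulrA -expr2 sqr_i mulN1r.
Qed.

Lemma polarized_ipDl F G L : H F -> H G -> H L ->
  polarized_ip N (F + G) L = polarized_ip N F L + polarized_ip N G L.
Proof.
by move=> hF hG hL; rewrite /polarized_ip !polarizedDl//; exact: iF.
Qed.

Lemma polarized_ipZl (a : C) F G : H F -> H G ->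
  polarized_ip N (a *' F) G = a * polarized_ip N F G.
Proof.
move=> hF hG; case: a => u v.
have aFE : (u +i* v) *' F = u%:C *' F + v%:C *' ('i *' F).
  apply/funext => x; rewrite [RHS]/GRing.add /=.
  by rewrite mulrA -mulrDl; congr (_ * _); simpc.
have [hiF hiG] := (iF hF, iF hG).
have [huF hviF] := (HZ u%:C hF, HZ v%:C hiF).
rewrite /polarized_ip aFE !polarizedDl ?polarizedZl//.
rewrite polarized_il// polarized_ii//.
by simpc; congr (_ +i* _); ring.
Qed.

Lemma polarized_ip_herm F G : H F -> H G ->
  polarized_ip N G F = conjc (polarized_ip N F G).
Proof.
move=> hF hG; rewrite /polarized_ip [RHS]/=; congr (_ +i* _).
  exact: polarizedC.
by rewrite (polarizedC hG (iF hF)) polarized_il.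
Qed.

(** The imaginary part vanishes because [1 + i] and [1 - i] have the same modulus. *)
Lemma polarized_ipxx F : H F -> polarized_ip N F F = (N F)%:C.
Proof.
move=> hF; rewrite /polarized_ip /polarized; congr (_ +i* _).
  have -> : F + F = 2%:C *' F.
    by apply/funext => x; rewrite [LHS]/GRing.add/= rmorph_nat mulr_natl mulr2n.
  have -> : F - F = 0 *' F by rewrite subrr; apply/funext => x; rewrite mul0r.
  rewrite !NZ// normr0 /= expr0n addr0 sqrtr_sqr ger0_norm//.
  by rewrite mul0r subr0; field.
have -> : (F : X -> C) + 'i *' F = (1 +i* 1) *' F.
  by apply/funext => x; rewrite [LHS]/GRing.add/= -{1}[F x]mul1r -mulrDl; congr (_ * _); simpc.
have -> : (F : X -> C) - 'i *' F = (1 -i* 1) *' F.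
  apply/funext => x; rewrite [LHS]/GRing.add/= [X in _ + X]/GRing.opp/=.
  by rewrite -{1}[F x]mul1r -mulrBl; congr (_ * _); simpc.
by rewrite !NZ//= sqrrN subrr mul0r.
Qed.
End JordanVonNeumann.

(** * The reproducing kernel Hilbert space of a positive kernel *)

Lemma cauchy_seq_cvg {R : realType} (v : nat -> R) :
  (forall e : R, 0 < e -> exists n0 : nat, forall m n,
    (n0 <= m)%N -> (n0 <= n)%N -> `|v m - v n| < e) ->
  v @ \oo --> lim (v @ \oo).
Proof.
move=> cv; apply: cauchy_cvg; apply: cauchy_exP => e /cv[n0 h].
by exists (v n0); exists n0 => // n /= hn; exact: h.
Qed.

Section MooreAronszajn.
Context {R : realType} {X : Type} (K : X -> X -> R[i]).
Hypothesis pK : psd K.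
Local Notation C := R[i].
Local Notation Re := (@complex.Re R).
Local Notation Im := (@complex.Im R).
Implicit Types (F G : X -> C) (s r : seq (X * C)).

Let hK : hermitian K. Proof. by case: pK. Qed.

Let ReD (z w : C) : Re (z + w) = Re z + Re w.
Proof. exact: (raddfD (Re : Rcomplex R -> R)). Qed.

Let ReN (z : C) : Re (- z) = - Re z.
Proof. exact: (raddfN (Re : Rcomplex R -> R)). Qed.

Let ReJ (z : C) : Re (conjc z) = Re z. Proof. by case: z. Qed.

Let conjcJM (z w : C) : conjc (conjc z * w) = z * conjc w.
Proof. by rewrite rmorphM; congr (_ * _); exact: conjcK. Qed.

Let pairingB F G s : pairing (F - G) s = pairing F s - pairing G s.
Proof.
have := pairingD F (fun x => -1 * G x) s; rewrite pairingZ mulN1r => <-.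
by apply: eq_pairing => x; rewrite mulN1r.
Qed.

(* For [F] in the space, [energy F s] is [`|F|^2 - `|F - kcomb K s|^2]; its
   supremum over [s] is therefore [`|F|^2]. *)
Definition energy F s : R := 2 * Re (pairing F s) - Re (sform K s s).

(** Finiteness of the supremum of the energies singles out the reproducing space directly as a set
    of functions, without completing the span of the sections of [K]. *)
Definition native : set (X -> C) := [set F | exists c : R, forall s, energy F s <= c].

Definition sqnorm F : R := sup (range (energy F)).

Lemma energy_le_sqnorm F s : native F -> energy F s <= sqnorm F.
Proof.
move=> [c Fc]; apply: ub_le_sup; last by exists s.
by exists c => _ [r _ <-].
Qed.

Lemma sqnorm_le F c : (forall s, energy F s <= c) -> sqnorm F <= c.
Proof.
move=> Fc; apply: ge_sup; first by exists (energy F [::]); exists [::].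
by move=> _ [r _ <-].
Qed.

Lemma energy_nil F : energy F [::] = 0.
Proof. by rewrite /energy /sform !pairing_nil mulr0 subrr. Qed.

Lemma sqnorm_ge0 F : native F -> 0 <= sqnorm F.
Proof. by move=> /(energy_le_sqnorm [::]); rewrite energy_nil. Qed.

Lemma Re_sform_ge0 s : 0 <= Re (sform K s s).
Proof. by have [_ /(_ s)] := pK; rewrite lecE => /andP[]. Qed.

Lemma energyZ F (a : C) s : a != 0 ->
  energy (fun x => a * F x) s = Re `|a| ^+ 2 * energy F (wscale a^-1 s).
Proof.
move=> a0; have na : (Re `|a| ^+ 2)%:C = a * conjc a.
  by rewrite rmorphXn /= -normE normCK.
have ReZ (t : R) (z : C) : t * Re z = Re (t%:C * z).
  by case: z => u v /=; rewrite mul0r subr0.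
rewrite /energy mulrBr mulrCA !(ReZ (Re `|a| ^+ 2)) na pairingZ pairing_wscale.
rewrite sform_wscalel sform_wscaler fmorphV; congr (_ * Re _ - Re _).
  by rewrite -mulrA (mulrA (conjc a)) mulfV ?conjc_eq0// mul1r.
by field; rewrite a0 conjc_eq0.
Qed.

Lemma energy_double F s :
  energy F (wscale 2^-1 s ++ wscale 2^-1 s) = energy F s.
Proof.
have c2 : conjc 2^-1 = 2^-1 :> C by rewrite fmorphV rmorph_nat.
have -> : energy F (wscale 2^-1 s ++ wscale 2^-1 s) =
   2 * Re (pairing F s * (2^-1 + 2^-1)) -
   Re ((2^-1 + 2^-1) * (2^-1 + 2^-1) * sform K s s).
  rewrite /energy pairing_cat !sform_catl !sform_catr !sform_wscalel.
  rewrite !sform_wscaler pairing_wscale c2; congr (_ * Re _ - Re _); ring.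
have -> : 2^-1 + 2^-1 = 1 :> C by field.
by rewrite mulr1 !mul1r.
Qed.

Lemma energy_parallelogram F G s r :
  energy (F + G) (s ++ r) + energy (F - G) (s ++ wscale (-1) r) =
  2 * energy F s + 2 * energy G r.
Proof.
have c1 : conjc (-1) = -1 :> C by rewrite rmorphN rmorph1.
rewrite /energy pairingB (pairingD F) !pairing_cat !sform_catl !sform_catr.
rewrite !sform_wscalel !sform_wscaler !pairing_wscale c1 !mulN1r opprK.
by rewrite !(ReD, ReN); ring.
Qed.

Lemma energy_cancel F s r : energy F (s ++ wscale (-1) s ++ r) = energy F r.
Proof.
have c1 : conjc (-1) = -1 :> C by rewrite rmorphN rmorph1.
rewrite /energy !pairing_cat !sform_catl !sform_catr.
rewrite !sform_wscalel !sform_wscaler !pairing_wscale c1 !mulN1r opprK.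
by rewrite !(ReD, ReN); ring.
Qed.

Lemma energyB_kcomb F s r :
  energy (F - kcomb K s) r = energy F (s ++ r) - energy F s.
Proof.
rewrite /energy pairingB pairing_cat -/(sform K r s) sform_cat2//.
by rewrite !(ReD, ReN, ReJ); ring.
Qed.

Lemma native0 : native 0.
Proof.
exists 0 => s; rewrite /energy /pairing big1 => [|p _]; last by rewrite mulr0.
by rewrite mulr0 sub0r oppr_le0 Re_sform_ge0.
Qed.

Lemma sqnorm0 : sqnorm 0 = 0.
Proof.
apply/eqP; rewrite eq_le sqnorm_ge0 ?andbT; last exact: native0.
apply: sqnorm_le => s; rewrite /energy /pairing big1 => [|p _]; last by rewrite mulr0.
by rewrite mulr0 sub0r oppr_le0 Re_sform_ge0.
Qed.

Lemma nativeD F G : native F -> native G -> native (F + G).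
Proof.
move=> [c Fc] [d Gd]; exists (2 * c + 2 * d) => r.
(* Any list acts as [s ++ s] with halved weights. In the parallelogram identity with both lists
   equal to [s], the term of [F - G] then has the zero measure and disappears. *)
rewrite -energy_double; set s := wscale 2^-1 r.
have -> : energy (F + G) (s ++ s) = 2 * energy F s + 2 * energy G s.
  have := energy_cancel (F - G) s [::]; rewrite cats0 energy_nil => e0.
  by rewrite -energy_parallelogram e0 addr0.
have := Fc s; have := Gd s; lra.
Qed.

Lemma mul0_fct F : (fun x => 0 * F x) = 0.
Proof. by apply/funext => x; rewrite mul0r. Qed.

Lemma nativeZ (a : C) F : native F -> native (fun x => a * F x).
Proof.
have [->|a0] := eqVneq a 0; first by rewrite mul0_fct => _; exact: native0.
move=> [c Fc]; exists (Re `|a| ^+ 2 * c) => s.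
by rewrite energyZ// ler_wpM2l// sqr_ge0.
Qed.

Lemma nativeB F G : native F -> native G -> native (F - G).
Proof.
move=> hF /(nativeZ (-1)) hG; rewrite (_ : F - G = F + (fun x => -1 * G x)).
  exact: nativeD.
by apply/funext => x; rewrite [RHS]/GRing.add/= mulN1r.
Qed.

(** One inequality follows from [energyZ]; the other is the same inequality for the scalar
    [a^-1]. *)
Lemma sqnormZ (a : C) F : native F ->
  sqnorm (fun x => a * F x) = Re `|a| ^+ 2 * sqnorm F.
Proof.
have [->|a0] := eqVneq a 0.
  by rewrite mul0_fct sqnorm0 normr0 expr0n mul0r.
have le_Z (b : C) G : b != 0 -> native G ->
    sqnorm (fun x => b * G x) <= Re `|b| ^+ 2 * sqnorm G.
  move=> b0 hG; apply: sqnorm_le => s; rewrite energyZ//.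
  by rewrite ler_wpM2l ?sqr_ge0// energy_le_sqnorm.
move=> hF; apply/eqP; rewrite eq_le le_Z//=.
have na : 0 < Re `|a| ^+ 2 by rewrite exprn_gt0// Re_norm_gt0.
have := le_Z a^-1 (fun x => a * F x); rewrite invr_eq0 => /(_ a0 (nativeZ a hF)).
have -> : (fun x => a^-1 * (a * F x)) = F by apply/funext => x; rewrite mulKf.
have -> : Re `|a^-1| = (Re `|a|)^-1 by rewrite normfV normE -fmorphV.
by rewrite exprVn mulrC ler_pdivlMr// mulrC.
Qed.

(** Independent suprema over the two lists of [energy_parallelogram] give one inequality; the same
    inequality for [F + G] and [F - G] is the converse. *)
Lemma sqnorm_parallelogram F G : native F -> native G ->
  sqnorm (F + G) + sqnorm (F - G) = 2 * sqnorm F + 2 * sqnorm G.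
Proof.
have ge_par F' G' : native F' -> native G' ->
    2 * sqnorm F' + 2 * sqnorm G' <= sqnorm (F' + G') + sqnorm (F' - G').
  move=> hF hG; set c := leRHS.
  have h s r : 2 * energy F' s + 2 * energy G' r <= c.
    rewrite -energy_parallelogram lerD ?energy_le_sqnorm//.
      exact: nativeD.
    exact: nativeB.
  have : sqnorm F' <= c / 2 - sqnorm G'.
    apply: sqnorm_le => s.
    have : sqnorm G' <= c / 2 - energy F' s.
      by apply: sqnorm_le => r; have := h s r; lra.
    lra.
  lra.
move=> hF hG; apply/eqP; rewrite eq_le ge_par// andbT.
have := ge_par _ _ (nativeD hF hG) (nativeB hF hG).
have -> : F + G + (F - G) = (fun x => 2 * F x).
  by rewrite addrACA subrr addr0; apply/funext => x; rewrite mulr_natl mulr2n.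
have -> : F + G - (F - G) = (fun x => 2 * G x).
  by rewrite opprB (addrC F) addrACA subrr addr0; apply/funext => x; rewrite mulr_natl mulr2n.
rewrite !sqnormZ//.
have -> : Re `|2 : C| = 2 by rewrite normr_nat -(rmorph_nat (real_complex R)).
lra.
Qed.

Lemma energy_kcomb s : energy (kcomb K s) s = Re (sform K s s).
Proof. rewrite /energy /sform; ring. Qed.

Lemma native_kcomb s : native (kcomb K s).
Proof.
exists (Re (sform K s s)) => r.
have := energyB_kcomb (kcomb K s) s (wscale (-1) s ++ r).
rewrite energy_cancel subrr energy_kcomb /energy {1}/pairing big1 => [|p _]; last by rewrite mulr0.
have := Re_sform_ge0 (wscale (-1) s ++ r); lra.
Qed.

(** Subtracting [kcomb K s] translates the argument of the energy by [s], and every measure is such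
    a translate. *)
Lemma sqnormB_kcomb F s : native F ->
  sqnorm (F - kcomb K s) = sqnorm F - energy F s.
Proof.
move=> hF; apply/eqP; rewrite eq_le; apply/andP; split.
  by apply: sqnorm_le => r; rewrite energyB_kcomb lerD2r energy_le_sqnorm.
rewrite lerBlDr; apply: sqnorm_le => r.
rewrite -(energy_cancel F s r) -lerBlDr -energyB_kcomb energy_le_sqnorm//.
exact: nativeB (native_kcomb s).
Qed.

Definition native_ip := polarized_ip sqnorm.

Let ipxx F : native F -> native_ip F F = (sqnorm F)%:C.
Proof. exact: (polarized_ipxx sqnormZ). Qed.

Lemma hnorm_native F : native F -> hnorm native_ip F = Num.sqrt (sqnorm F).
Proof. by move=> hF; rewrite /hnorm ipxx. Qed.

Lemma polarized_kcomb F s : native F ->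
  polarized sqnorm F (kcomb K s) = Re (pairing F s).
Proof.
move=> hF; rewrite /polarized sqnormB_kcomb//.
have c1 : conjc (-1) = -1 :> C by rewrite rmorphN rmorph1.
have -> : F + kcomb K s = F - kcomb K (wscale (-1) s).
  apply/funext => x; congr (_ + _).
  by rewrite [RHS]/GRing.opp/= kcomb_wscale mulN1r opprK.
rewrite sqnormB_kcomb// /energy pairing_wscale sform_wscalel sform_wscaler c1.
by rewrite !mulN1r opprK ReN; field.
Qed.

Lemma native_reproducing F y : native F -> native_ip F (K ^~ y) = F y.
Proof.
move=> hF; rewrite /native_ip /polarized_ip.
have -> : (fun x => 'i * K x y) = kcomb K [:: (y, 'i)].
  by apply/funext => x; rewrite kcomb1.
have -> : K ^~ y = kcomb K [:: (y, 1)].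
  by apply/funext => x; rewrite kcomb1 mul1r.
rewrite !polarized_kcomb// !pairing1 conjc1 mul1r.
by case: (F y) => u v; simpc.
Qed.

Lemma native_eval F x : native F ->
  Re `|F x| ^+ 2 <= (Re (K x x) + 1) * sqnorm F.
Proof.
move=> hF; set k := Re (K x x).
have k0 : 0 <= k by have := psd_ge0 x pK; rewrite lecE => /andP[].
have Kxx : K x x = k%:C.
  by have := ger0_Im (psd_ge0 x pK); rewrite /k; case: (K x x) => u v /= ->.
(* The optimal weight at [x] would be [F x / k]; adding 1 to [k] covers the case [k = 0]. *)
pose t := (k + 1)^-1.
have t0 : 0 < t by rewrite invr_gt0 ltr_wpDl.
have tk : t * (k + 1) = 1 by rewrite mulVf ?gt_eqF// ltr_wpDl.
have := energy_le_sqnorm [:: (x, t%:C * F x)] hF.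
rewrite /energy pairing1 sform1 conjcZ Kxx.
have -> : t%:C * conjc (F x) * F x = (t * Re `|F x| ^+ 2)%:C.
  rewrite rmorphM rmorphXn /= -normE normCK; ring.
have -> : t%:C * conjc (F x) * (t%:C * F x * k%:C) = (t * t * k * Re `|F x| ^+ 2)%:C.
  rewrite 3!rmorphM rmorphXn /= -normE normCK; ring.
rewrite /= => h; set a := Re `|F x| ^+ 2 in h *.
have a0 : 0 <= a by rewrite sqr_ge0.
have tk1 : t * k <= 1 by have := t0; lra.
have : t * a <= sqnorm F.
  apply: le_trans h; have -> : t * t * k * a = (t * a) * (t * k) by ring.
  have : (t * a) * (t * k) <= t * a by apply: ler_piMr => //; apply: mulr_ge0 => //; exact: ltW.
  lra.
rewrite -(ler_pM2l (ltr_wpDl k0 (@ltr01 R))) mulrA (mulrC _ t) tk mul1r.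
by [].
Qed.

Lemma native_hilbert : is_hilbert_fct native native_ip.
Proof.
have par := sqnorm_parallelogram.
split.
- exact: native0.
- exact: nativeD.
- exact: nativeZ.
- exact: (polarized_ipDl nativeD nativeZ sqnormZ par).
- exact: (polarized_ipZl nativeD nativeZ sqnorm_ge0 sqnormZ par).
- exact: (polarized_ip_herm nativeD nativeZ sqnormZ).
- move=> F hF F0; rewrite ipxx// ltcR lt_def sqnorm_ge0// andbT.
  apply/eqP => n0; apply: F0; apply/funext => x.
  have := native_eval x hF; rewrite n0 mulr0 => e.
  have /eqP : Re `|F x| ^+ 2 = 0 by apply/eqP; rewrite eq_le e sqr_ge0.
  rewrite sqrf_eq0 => /eqP Fx0; apply/eqP; rewrite -normr_eq0 normE Fx0.
  by [].
move=> u hu cu.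
have cu2 (e : R) : 0 < e -> exists n0, forall m n, (n0 <= m)%N -> (n0 <= n)%N ->
    sqnorm (u m - u n) < e.
  move=> e0; have [|n0 h] := cu (Num.sqrt e); first by rewrite sqrtr_gt0.
  exists n0 => m n hm hn; have := h m n hm hn.
  by rewrite hnorm_native ?ltr_sqrt//; exact: nativeB.
(* Norm convergence controls values through [native_eval], so a Cauchy sequence has a pointwise
   limit, the candidate [F]. *)
have cux x (e : R) : 0 < e -> exists n0, forall m n, (n0 <= m)%N -> (n0 <= n)%N ->
    Re `|u m x - u n x| < e.
  move=> e0; set k := Re (K x x) + 1.
  have k0 : 0 < k.
    by rewrite ltr_wpDl//; have := psd_ge0 x pK; rewrite lecE => /andP[].
  have [|n0 h] := cu2 (e ^+ 2 / k); first by rewrite divr_gt0// exprn_gt0.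
  exists n0 => m n hm hn; have := h m n hm hn.
  have nn : 0 <= Re `|u m x - u n x| by rewrite (le_trans _ (norm_Re_le _)).
  rewrite ltr_pdivlMr// mulrC => h'; rewrite -(@ltr_pXn2r _ 2)// ?nnegrE ?ltW//.
  exact: le_lt_trans (native_eval x (nativeB (hu m) (hu n))) h'.
pose F x := lim ((fun n => Re (u n x)) @ \oo) +i* lim ((fun n => Im (u n x)) @ \oo).
have cRe x : (fun n => Re (u n x)) @ \oo --> Re (F x).
  apply: cauchy_seq_cvg => e /(cux x)[n0 h]; exists n0 => m n hm hn.
  rewrite -ReN -ReD; exact: le_lt_trans (norm_Re_le _) (h m n hm hn).
have cIm x : (fun n => Im (u n x)) @ \oo --> Im (F x).
  apply: cauchy_seq_cvg => e /(cux x)[n0 h]; exists n0 => m n hm hn.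
  rewrite -(raddfB (Im : Rcomplex R -> R)).
  exact: le_lt_trans (norm_Im_le _) (h m n hm hn).
(* For a fixed list the energy involves finitely many values and follows pointwise limits; bounds
   uniform in [s] thus pass to the norm of [u m - F]. *)
have cE m s : (fun n => energy (u m - u n) s) @ \oo --> energy (u m - F) s.
  rewrite /energy; under eq_fun do rewrite pairingB ReD ReN.
  rewrite pairingB ReD ReN; apply: cvgB; last exact: cvg_cst.
  apply: cvgMl_tmp; apply: cvgB; first exact: cvg_cst.
  have RepE G : Re (pairing G s) =
      \sum_(p <- s) (Re (conjc p.2) * Re (G p.1) - Im (conjc p.2) * Im (G p.1)).
    rewrite /pairing (raddf_sum (Re : Rcomplex R -> R)); apply: eq_bigr => p _.
    by case: (conjc p.2) => a b; case: (G p.1).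
  under eq_fun do rewrite RepE.
  rewrite RepE; apply: (cvg_big (@add_continuous R)) => p _.
  by apply: cvgB; apply: cvgMl_tmp.
have hF (e : R) : 0 < e -> exists n0, forall m, (n0 <= m)%N ->
    forall s, energy (u m - F) s <= e.
  move=> /cu2[n0 h]; exists n0 => m hm s; apply: (cvgr_to_le (cE m s)).
  exists n0 => // n /= hn; apply: (le_trans (energy_le_sqnorm s _)).
    exact: nativeB.
  exact: ltW (h m n hm hn).
have nF : native F.
  have [n0 h] := hF 1 ltr01.
  have : native (u n0 - F) by exists 1; exact: h.
  by move=> /(nativeB (hu n0)); rewrite opprB addrC subrK.
exists F => //; apply/cvgrPdist_le => e e0.
have [|n0 h] := hF (e ^+ 2); first by rewrite exprn_gt0.
exists n0 => // n /= hn; rewrite sub0r normrN ger0_norm ?sqrtr_ge0//.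
rewrite hnorm_native; last exact: nativeB.
rewrite -[leRHS](ger0_norm (ltW e0)) -sqrtr_sqr ler_wsqrtr// sqnorm_le//.
exact: h.
Qed.

Lemma kcomb_sum s : exists n (y : 'I_n -> X) (c : 'I_n -> C),
  kcomb K s = (fun x => \sum_(i < n) c i * K x (y i)).
Proof.
exists (size s), (fun i => (tnth (in_tuple s) i).1), (fun i => (tnth (in_tuple s) i).2).
by apply/funext => x; rewrite /kcomb big_tnth.
Qed.

Lemma native_rkhs : is_rkhs K native native_ip.
Proof.
split.
- exact: native_hilbert.
- move=> y; have -> : K ^~ y = kcomb K [:: (y, 1)].
    by apply/funext => x; rewrite kcomb1 mul1r.
  exact: native_kcomb.
- by move=> F y hF; exact: native_reproducing.
- move=> F e hF e0.
  have hs : has_sup (range (energy F)).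
    split; first by exists (energy F [::]); exists [::].
    by have [c Fc] := hF; exists c => _ [r _ <-].
  have e20 : 0 < e ^+ 2 by rewrite exprn_gt0.
  (* A list whose energy is within [e ^+ 2] of the supremum gives an approximant, by
     [sqnormB_kcomb]. *)
  have [_ [s _ <-] hs'] := sup_adherent e20 hs.
  have [n [y [c sE]]] := kcomb_sum s; exists n, y, c; rewrite -sE.
  rewrite hnorm_native; last exact: nativeB (native_kcomb s).
  rewrite sqnormB_kcomb// -[ltRHS](ger0_norm (ltW e0)) -sqrtr_sqr ltr_sqrt//.
  by rewrite ltrBlDr addrC -ltrBlDr.
Qed.

Lemma native_sub_rkhs : native `<=` rkhs K.
Proof. by move=> F hF; exists native, native_ip; split => //; exact: native_rkhs. Qed.

(* If [a * K - F F^*] is positive, then [`|pairing F s|^2 <= a * sform K s s], so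
   that [energy F s <= 2 `|z| - `|z|^2 / a <= a] for [z = pairing F s]. *)
Lemma native_dominated F (a : R) : 0 < a ->
  psd (fun x y => a%:C * K x y - F x * conjc (F y)) -> native F.
Proof.
move=> a0 [_ pF]; exists a => s; have := pF s.
have -> : sform (fun x y => a%:C * K x y - F x * conjc (F y)) s s =
    a%:C * sform K s s - pairing F s * conjc (pairing F s).
  rewrite -sformZ -[- (_ * _)]mulNr.
  rewrite -[X in - _ * X]/(conjc (pairing F s)) mulNr mulrC -pairingZ -pairingB.
  apply: eq_pairing => x.
  rewrite /kcomb [RHS]/GRing.add /= [X in _ + X]/GRing.opp /= rmorph_sum mulr_suml -sumrB.
  apply: eq_bigr => q _; rewrite -[X in _ = _ - X * _]/(conjc (conjc q.2 * F q.1)) conjcJM; ring.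
rewrite lecE => /andP[_]; rewrite /energy.
case: (pairing F s) => u v; case: (sform K s s) => q q' /=.
rewrite mul0r subr0 => h.
have h2 : 0 <= (u - a) ^+ 2 + v ^+ 2 by rewrite addr_ge0 ?sqr_ge0.
rewrite -subr_ge0 -(pmulr_rge0 _ a0); nra.
Qed.
End MooreAronszajn.

(** * The Stone-Weierstrass theorem *)

(** If [P A] fails, the sets [B] such that [P] holds of [A] minus [B] form a proper filter
    containing [A]. Near a cluster point in [A], the local hypothesis contradicts clustering. *)
Lemma compact_ind {X : topologicalType} (A : set X) (P : set X -> Prop) :
  compact A -> P set0 -> (forall U V, P U -> P V -> P (U `|` V)) ->
  (forall U V, U `<=` V -> P V -> P U) ->
  (forall x, A x -> exists2 U, nbhs x U & P (A `&` U)) -> P A.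
Proof.
move=> cA P0 PU Psub Ploc; apply: contrapT => nPA.
pose F : set_system X := [set B | P (A `&` ~` B)].
have FF : Filter F.
  split=> [|B C FB FC|B C BC].
  - by rewrite /F /= setCT setI0.
  - by rewrite /F /= setCI setIUr; exact: PU.
  - by apply: Psub; apply: setIS; exact: subsetC.
have PF : ProperFilter F.
  by split=> //; rewrite /F /= setC0 setIT.
have FA : F A by rewrite /F /= setICr.
have [x [Ax Fx]] := cA F PF FA.
have [U Ux PAU] := Ploc x Ax.
have FU : F (~` U) by rewrite /F /= setCK.
by have [y [nUy /nUy]] := Fx _ _ FU Ux.
Qed.

Section StoneWeierstrass.
Context {R : realType} {X : topologicalType} (T : set (X -> R)).
Hypothesis Tcst : forall c : R, T (fun=> c).
Hypothesis TD : forall p q, T p -> T q -> T (fun x => p x + q x).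
Hypothesis TM : forall p q, T p -> T q -> T (fun x => p x * q x).
Hypothesis Tbounded : forall p, T p -> exists B : R, forall x, `|p x| <= B.
Hypothesis Tcontinuous : forall p, T p -> continuous p.
Hypothesis Tseparates : forall x y, x <> y -> exists2 p, T p & p x <> p y.
Implicit Types p q u v : X -> R.

Definition uniform_closure : set (X -> R) :=
  [set u | forall e : R, 0 < e -> exists2 p, T p & forall x, `|u x - p x| <= e].

Local Notation S := uniform_closure.

Let TZ (c : R) p : T p -> T (fun x => c * p x).
Proof. exact: TM. Qed.

Let TB p q : T p -> T q -> T (fun x => p x - q x).
Proof.
move=> Tp Tq; have := TD Tp (TZ (-1) Tq); congr T.
by apply/funext => x; rewrite mulN1r.
Qed.

Let sub_closure p : T p -> S p.
Proof. by move=> Tp e e0; exists p => // x; rewrite subrr normr0 ltW. Qed.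

Let SD u v : S u -> S v -> S (fun x => u x + v x).
Proof.
move=> Su Sv e e0; have e20 : 0 < e / 2 by rewrite divr_gt0.
have [p Tp up] := Su _ e20; have [q Tq vq] := Sv _ e20.
exists (fun x => p x + q x); first exact: TD.
move=> x; rewrite opprD addrACA (le_trans (ler_normD _ _))// [e]splitr.
by rewrite lerD.
Qed.

Let SZ (c : R) u : S u -> S (fun x => c * u x).
Proof.
move=> Su e e0; have c0 : 0 < `|c| + 1 by rewrite ltr_wpDl.
have [p Tp up] := Su (e / (`|c| + 1)) (divr_gt0 e0 c0).
exists (fun x => c * p x); first exact: TZ.
move=> x; rewrite -mulrBr normrM (@le_trans _ _ ((`|c| + 1) * `|u x - p x|))//.
  by rewrite ler_wpM2r// lerDl.
by rewrite mulrC -ler_pdivlMr.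
Qed.

(* The iteration [r_(n+1) = r_n + (q ^ 2 - r_n ^ 2) / 2] increases to [`|q|]. *)
Let abs_step (q : R) (r : nat -> R) : `|q| <= 1 -> r 0%N = 0 ->
  (forall n, r n.+1 = r n + (q ^+ 2 - r n ^+ 2) / 2) ->
  forall n, 0 <= `|q| - r n /\ 0 <= r n /\ n.+2%:R * (`|q| - r n) <= 2.
Proof.
move=> q1 r0 rS; elim=> [|n [IH1 [IH2 IH3]]].
  by rewrite r0 subr0; split=> //; split=> //; lra.
rewrite rS -(real_normK (num_real q)); set t := `|q| in q1 IH1 IH3 *.
have t0 : 0 <= t by exact: normr_ge0.
have E : t - (r n + (t ^+ 2 - r n ^+ 2) / 2) = (t - r n) * (1 - (t + r n) / 2).
  by field.
split; [|split].
- by rewrite E mulr_ge0//; lra.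
- by nra.
rewrite E -natr1; set N : R := n.+2%:R in IH3 *.
set d := t - r n in IH1 IH3 *.
(* As [r n >= 0], [t + r n] is at least the error [d]. The recursion bounds the next error by
   [d * (1 - d / 2)], which preserves the rate [2 / (n + 2)]. *)
have : d * (1 - (t + r n) / 2) <= d * (1 - d / 2).
  by rewrite ler_wpM2l// /d; lra.
have N0 : 0 <= N by rewrite ler0n.
move=> h; have : (N + 1) * (d * (1 - (t + r n) / 2)) <= (N + 1) * (d * (1 - d / 2)).
  by rewrite ler_wpM2l// addr_ge0.
have d2 : 0 <= 1 - d / 2 by rewrite /d; lra.
have : (N * d) * (1 - d / 2) <= 2 * (1 - d / 2) by rewrite ler_wpM2r.
nra.
Qed.

Let T_abs p : T p -> S (fun x => `|p x|).
Proof.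
move=> Tp e e0; have [B0 pB0] := Tbounded Tp; pose B := `|B0| + 1.
have B_gt0 : 0 < B by rewrite ltr_wpDl.
have pB x : `|p x / B| <= 1.
  rewrite normrM normfV (ger0_norm (ltW B_gt0)) ler_pdivrMr// mul1r.
  by rewrite (le_trans (pB0 x))// (le_trans (ler_norm _))// lerDl.
pose r := fix r n : X -> R := if n is m.+1 then
  fun x => r m x + ((p x / B) ^+ 2 - r m x ^+ 2) / 2 else fun=> 0.
have Tr n : T (r n).
  elim: n => [|n IH] /=; first exact: Tcst.
  have Tq : T (fun x => p x / B) by apply: TM => //; exact: Tcst.
  apply: TD => //; apply: TM; last exact: Tcst.
  by apply: TB; exact: TM.
(* This makes [B] times the error bound [2 / (n + 2)] smaller than [e]. *)
pose n := Num.truncn (2 * B / e).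
exists (fun x => B * r n x); first exact: TZ.
move=> x; have [d0 [_ d2]] := @abs_step (p x / B) (r^~ x) (pB x) erefl (fun=> erefl) n.
have -> : `|p x| = B * `|p x / B|.
  by rewrite normrM normfV (ger0_norm (ltW B_gt0)) mulrC divfK ?gt_eqF.
rewrite -mulrBr normrM (ger0_norm (ltW B_gt0)) (ger0_norm d0).
have nB : 2 * B / e < n.+2%:R.
  by rewrite (lt_trans (truncnS_gt _))// ltr_nat.
rewrite ltr_pdivrMr// in nB.
rewrite -(ler_pM2l (ltr0Sn R n.+1)) mulrCA.
apply: le_trans (ltW nB); rewrite (mulrC 2) ler_wpM2l// ltW//.
Qed.

Let S_abs u : S u -> S (fun x => `|u x|).
Proof.
move=> Su e e0; have e20 : 0 < e / 2 by rewrite divr_gt0.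
have [p Tp up] := Su _ e20; have [q Tq pq] := T_abs Tp e20.
exists q => // x; rewrite [e]splitr -(subrK `|p x| `|u x|) -addrA.
rewrite (le_trans (ler_normD _ _))// lerD//.
exact: le_trans (ler_dist_dist _ _) (up x).
Qed.

Let S_max u v : S u -> S v -> S (fun x => Num.max (u x) (v x)).
Proof.
move=> Su Sv.
have := SZ 2^-1 (SD (SD Su Sv) (S_abs (SD Su (SZ (-1) Sv)))); congr S.
by apply/funext => x; rewrite maxr_absE mulN1r mulrC.
Qed.

Let S_min u v : S u -> S v -> S (fun x => Num.min (u x) (v x)).
Proof.
move=> Su Sv.
have := SZ (-1) (S_max (SZ (-1) Su) (SZ (-1) Sv)); congr S.
by apply/funext => x; rewrite !mulN1r -oppr_min opprK.
Qed.

Let S_continuous u : S u -> continuous u.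
Proof.
move=> Su x; apply/cvgrPdist_lt => e e0.
have e40 : 0 < e / 4 by rewrite divr_gt0.
have [p Tp up] := Su _ e40.
have /(_ x)/cvgrPdist_lt/(_ _ e40) := Tcontinuous Tp.
apply: filterS => z pz.
have h1 := up x; have h2 := up z; rewrite distrC in h2.
have -> : u x - u z = (u x - p x) + (p x - p z) + (p z - u z) by ring.
apply: le_lt_trans (ler_normD _ _) _.
have := ler_normD (u x - p x) (p x - p z).
lra.
Qed.

Let interpolate x y (a b : R) : x <> y -> exists u, [/\ S u, u x = a & u y = b].
Proof.
move=> /Tseparates[p Tp] pxy.
have d0 : p x - p y != 0 by rewrite subr_eq0; apply/eqP.
exists (fun z => b + (a - b) / (p x - p y) * (p z - p y)); split.
- apply: sub_closure; apply: TD; first exact: Tcst.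
  by apply: TZ; apply: TB => //; exact: Tcst.
- by field.
- by rewrite subrr mulr0 addr0.
Qed.

Let above_near (u q : X -> R) (e : R) y : continuous u -> continuous q ->
  q y - e < u y -> nbhs y [set z | q z - e < u z].
Proof.
move=> cu cq h.
have : (fun z => u z - q z) @ y --> u y - q y by apply: cvgB; [exact: cu|exact: cq].
move=> /cvgr_gt/(_ (- e)); rewrite ltrBrDr addrC => /(_ h).
by apply: filterS => z /=; lra.
Qed.

(** For each [y], some function interpolates [q] at [x] and [y], hence exceeds [q - e] near [y];
    compactness reduces to a finite maximum, which keeps the value at [x]. *)
Let approx_above (A : set X) q (e : R) x : compact A -> continuous q -> 0 < e ->
  exists u, [/\ S u, u x = q x & forall z, A z -> q z - e < u z].
Proof.
move=> cA cq e0.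
apply: (@compact_ind _ _ (fun B => exists u, [/\ S u, u x = q x &
   forall z, B z -> q z - e < u z]) cA).
- by exists (fun=> q x); split=> //; exact: sub_closure.
- move=> U V [u [Su ux uU]] [v [Sv vx vV]].
  exists (fun z => Num.max (u z) (v z)); split; first exact: S_max.
    by rewrite ux vx maxxx.
  by move=> z [/uU|/vV] h; rewrite lt_max h ?orbT.
- by move=> U V UV [u [Su ux uV]]; exists u; split=> // z /UV; exact: uV.
move=> y _; have [u [Su ux uy]] : exists u, [/\ S u, u x = q x & u y = q y].
  have [<-|xy] := pselect (x = y); last exact: interpolate.
  by exists (fun=> q x); split=> //; exact: sub_closure.
exists [set z | q z - e < u z].
  by apply: above_near => //; [exact: S_continuous|rewrite uy; lra].
by exists u; split=> // z [].
Qed.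

(** The functions of [approx_above] stay below [q + e] near their base point, and a finite minimum
    of them does so on all of [A]. *)
Let approx_compact (A : set X) q (e : R) : compact A -> continuous q -> 0 < e ->
  exists u, S u /\ forall z, A z -> `|u z - q z| < e.
Proof.
move=> cA cq e0.
have [A0|/set0P[x0 Ax0]] := eqVneq A set0.
  by exists (fun=> 0); split; [exact: sub_closure|rewrite A0].
suff [u [Su uA uA']] : exists u, [/\ S u, forall z, A z -> q z - e < u z &
    forall z, A z -> u z < q z + e].
  exists u; split=> // z Az; rewrite ltr_norml.
  by have := uA z Az; have := uA' z Az; lra.
apply: (@compact_ind _ _ (fun B => exists u, [/\ S u,
   forall z, A z -> q z - e < u z & forall z, B z -> u z < q z + e]) cA).
- by have [u [Su _ uA]] := approx_above x0 cA cq e0; exists u.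
- move=> U V [u [Su uA uU]] [v [Sv vA vV]].
  exists (fun z => Num.min (u z) (v z)); split; first exact: S_min.
    by move=> z Az; rewrite lt_min uA ?vA.
  by move=> z [/uU|/vV] h; rewrite gt_min h ?orbT.
- by move=> U V UV [u [Su uA uV]]; exists u; split=> // z /UV; exact: uV.
move=> x _; have [u [Su ux uA]] := approx_above x cA cq e0.
exists [set z | u z < q z + e]; last by exists u; split=> // z [].
have : nbhs x [set z | u z - e < q z].
  by apply: above_near => //; [exact: S_continuous|rewrite ux; lra].
by apply: filterS => z /=; lra.
Qed.

(** Truncation to [-B, B] before the last approximation by [T] bounds the result on the whole space,
    even though [q] is approximated only on [A]. *)
Lemma stone_weierstrass_bounded (A : set X) q (B e : R) :
  compact A -> continuous q -> (forall x, `|q x| <= B) -> 0 < e ->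
  exists2 p, T p & (forall x, `|p x| <= B + e) /\
                   (forall x, A x -> `|p x - q x| < e).
Proof.
move=> cA cq qB e0; have e20 : 0 < e / 2 by rewrite divr_gt0.
have [u [Su uq]] := approx_compact cA cq e20.
have Sv : S (fun x => Num.max (- B) (Num.min B (u x))).
  by apply: S_max; [|apply: S_min => //]; exact: sub_closure.
have [p Tp vp] := Sv _ e20.
exists p => //; split=> x => [|Ax].
  move: (vp x) (qB x); rewrite distrC ler_distl !ler_norml => /andP[h1 h2] /andP[h3 h4].
  by move: h1 h2; case: (leP B (u x)) => ?; case: (leP (- B) _) => ?; lra.
move: (vp x) (qB x) (uq x Ax).
rewrite distrC ler_distl ler_norml !ltr_distl => /andP[h1 h2] /andP[h3 h4] /andP[h5 h6].
by move: h1 h2; case: (leP B (u x)) => ?; case: (leP (- B) _) => ?; lra.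
Qed.
End StoneWeierstrass.

(** * Trigonometric polynomials and weighted approximation *)

Section TrigonometricPolynomials.
Context {R : realType} {X : topologicalType} (V : set (X -> R)).
Hypothesis V0 : V (fun=> 0).
Hypothesis VD : forall s t, V s -> V t -> V (fun x => s x + t x).
Hypothesis VZ : forall (c : R) t, V t -> V (fun x => c * t x).
Implicit Types p q : X -> R.

(** The phase [a] makes sines unnecessary: for a real vector space [V], these are the real-valued
    members of the complex span of the exponentials of [i t], with [t] in [V]. *)
Inductive trigpoly : (X -> R) -> Prop :=
| TrigCos t a : V t -> trigpoly (fun x => cos (t x + a))
| TrigAdd p q : trigpoly p -> trigpoly q -> trigpoly (fun x => p x + q x)
| TrigScale (c : R) p : trigpoly p -> trigpoly (fun x => c * p x).

Lemma trigpoly_cst (c : R) : trigpoly (fun=> c).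
Proof.
have := TrigScale c (TrigCos 0 V0); congr trigpoly.
by apply/funext => x; rewrite addr0 cos0 mulr1.
Qed.

Lemma trigpolyM p q : trigpoly p -> trigpoly q -> trigpoly (fun x => p x * q x).
Proof.
move=> Tp Tq; elim: Tp => {p} [s a Vs|p p' _ IH _ IH'|c p _ IH]; last first.
- have := TrigScale c IH; congr trigpoly.
  by apply/funext => x; rewrite mulrA.
- have := TrigAdd IH IH'; congr trigpoly.
  by apply/funext => x; rewrite mulrDl.
elim: Tq => {q} [t b Vt|q q' _ IH _ IH'|c q _ IH]; last first.
- have := TrigScale c IH; congr trigpoly.
  by apply/funext => x; rewrite mulrCA.
- have := TrigAdd IH IH'; congr trigpoly.
  by apply/funext => x; rewrite mulrDr.
have := TrigScale 2^-1 (TrigAdd (TrigCos (a + b) (VD Vs Vt))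
          (TrigCos (a - b) (VD Vs (VZ (-1) Vt)))); congr trigpoly.
apply/funext => x.
have -> : s x + t x + (a + b) = (s x + a) + (t x + b) by ring.
have -> : s x + -1 * t x + (a - b) = (s x + a) - (t x + b) by ring.
by rewrite cosD cosB; field.
Qed.

Lemma trigpoly_bounded p : trigpoly p -> exists B : R, forall x, `|p x| <= B.
Proof.
elim=> {p} [t a _|p q _ [B pB] _ [C qC]|c p _ [B pB]].
- by exists 1 => x; exact: cos_max.
- by exists (B + C) => x; rewrite (le_trans (ler_normD _ _))// lerD.
- by exists (`|c| * B) => x; rewrite normrM ler_wpM2l.
Qed.

Lemma trigpoly_continuous p : (forall t, V t -> continuous t) ->
  trigpoly p -> continuous p.
Proof.
move=> Vc; elim=> {p} [t a Vt|p q _ cp _ cq|c p _ cp] x.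
- apply: (@cvg_comp _ _ _ (fun x => t x + a) cos _ (nbhs (t x + a))).
    by apply: cvgD; [exact: Vc|exact: cvg_cst].
  exact: continuous_cos.
- by apply: cvgD; [exact: cp|exact: cq].
- by apply: cvgMl_tmp; exact: cp.
Qed.

Lemma trigpoly_separates x y t : V t -> t x <> t y ->
  exists2 p, trigpoly p & p x <> p y.
Proof.
move=> Vt txy; have d0 : t x - t y != 0 by rewrite subr_eq0; apply/eqP.
(* After this scaling the arguments at [x] and [y] differ by [pi], so the cosines are -1 and 1. *)
pose c := pi / (t x - t y).
exists (fun z => cos (c * t z + - (c * t y))); first exact/TrigCos/VZ.
rewrite -mulrBr /c mulfVK// subrr cospi cos0; lra.
Qed.
End TrigonometricPolynomials.

Lemma compact_bounded_norm {R : realType} {X : topologicalType} (A : set X) (u : X -> R) :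
  compact A -> continuous u -> exists B, forall x, A x -> `|u x| <= B.
Proof.
move=> cA cu; apply: (@compact_ind _ _ (fun U => exists B, forall x, U x -> `|u x| <= B) cA).
- by exists 0.
- move=> U V [B uB] [C uC]; exists (Num.max B C) => x [/uB|/uC] h.
    by rewrite le_max h.
  by rewrite le_max h orbT.
- by move=> U V UV [B uB]; exists B => x /UV; exact: uB.
move=> x _; exists [set z | `|u x - u z| < 1].
  by move/cvgrPdist_lt: (cu x); apply.
exists (`|u x| + 1) => z [_ /= h].
by have := ler_dist_dist (u x) (u z); rewrite ler_norml => /andP[]; lra.
Qed.

Lemma weighted_approximation {R : realType} {X : topologicalType}
    (T : set (X -> R)) (phi q : X -> R) (e : R) :
  (forall c : R, T (fun=> c)) ->
  (forall p p', T p -> T p' -> T (fun x => p x + p' x)) ->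
  (forall p p', T p -> T p' -> T (fun x => p x * p' x)) ->
  (forall p, T p -> exists B : R, forall x, `|p x| <= B) ->
  (forall p, T p -> continuous p) ->
  (forall x y, x <> y -> exists2 p, T p & p x <> p y) ->
  (forall x, 0 < phi x) -> continuous phi ->
  (forall d : R, 0 < d -> exists2 A, compact A & forall x, ~ A x -> phi x < d) ->
  continuous q ->
  (forall d : R, 0 < d -> exists2 A, compact A & forall x, ~ A x -> `|q x| < d) ->
  0 < e -> exists2 p, T p & forall x, `|phi x * p x - q x| <= e.
Proof.
move=> Tc TD TM Tb Tcont Tsep phi0 cphi phiC0 cq qC0 e0.
pose d := e / 2; have d0 : 0 < d by rewrite divr_gt0.
have [A cA qA] := qC0 _ d0.
have [M M0 phiM] : exists2 M, 0 < M & forall x, phi x <= M.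
  have [A1 cA1 phi1] := phiC0 _ ltr01.
  have [B phiB] := compact_bounded_norm cA1 cphi.
  exists (Num.max B 1) => [|x]; first by rewrite lt_max ltr01 orbT.
  have [/phiB h|/phi1/ltW h] := pselect (A1 x).
    by rewrite le_max (le_trans (ler_norm _) h).
  by rewrite le_max h orbT.
(* Soft thresholding of [q] at level [d]: it is continuous, moves [q] by at most [d] and gives 0
   outside [A]. *)
pose q' x := Num.max (q x - d) 0 + Num.min (q x + d) 0.
have q'q x : `|q' x - q x| <= d.
  rewrite /q' ler_norml; case: (leP (q x - d) 0) => ?; case: (leP (q x + d) 0) => ?; lra.
have q'0 x : ~ A x -> q' x = 0.
  move=> /qA; rewrite /q' ltr_norml => /andP[h1 h2].
  by case: (leP (q x - d) 0) => ?; case: (leP (q x + d) 0) => ?; lra.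
pose r x := q' x / phi x.
have phin0 x : phi x != 0 by rewrite gt_eqF.
have cr : continuous r.
  move=> x; apply: cvgM; last by apply: cvgV => //; exact: cphi.
  apply: cvgD.
    apply: (@continuous_max _ _ (fun x => q x - d) (fun=> 0)); last exact: cvg_cst.
    by apply: cvgB; [exact: cq|exact: cvg_cst].
  apply: (@continuous_min _ _ (fun x => q x + d) (fun=> 0)); last exact: cvg_cst.
  by apply: cvgD; [exact: cq|exact: cvg_cst].
have [B0 rB0] := compact_bounded_norm cA cr.
(* If [A] is empty, [B0] may be negative. *)
pose B := `|B0|.
have rB x : `|r x| <= B.
  have [/rB0 h|/q'0 h] := pselect (A x); first exact: le_trans h (ler_norm _).
  by rewrite /r h mul0r normr0 normr_ge0.
have B1 : 0 < B + 1 by rewrite ltr_wpDl ?normr_ge0.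
have [A' cA' phiA'] := phiC0 _ (divr_gt0 d0 B1).
(* The bound [d / M] controls the weighted error on the compact set, where [phi <= M]. The bound 1
   gives [|p| <= B + 1] elsewhere, where [phi < d / (B + 1)]. *)
pose e' := Num.min 1 (d / M).
have e'0 : 0 < e' by rewrite lt_min ltr01 divr_gt0.
have cAA' : compact (A `|` A') by exact: compactU.
have [p Tp [pB pr]] :=
  stone_weierstrass_bounded Tc TD TM Tb Tcont Tsep cAA' cr rB e'0.
exists p => // x.
suff h : `|phi x * p x - q' x| <= d.
  rewrite -(subrK (q' x) (phi x * p x)) -addrA (le_trans (ler_normD _ _))//.
  by rewrite [e]splitr lerD.
have phi_ge0 : 0 <= phi x by exact: ltW.
have [AA'x|nAA'x] := pselect ((A `|` A') x).
  have -> : phi x * p x - q' x = phi x * (p x - r x).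
    by rewrite mulrBr /r (mulrC (q' x)) mulrA mulfV// mul1r.
  rewrite normrM ger0_norm//.
  have h1 : `|p x - r x| <= d / M.
    by have := pr x AA'x; rewrite /e' lt_min => /andP[_ /ltW].
  apply: (@le_trans _ _ (M * (d / M))); first exact: ler_pM.
  by rewrite mulrC divfK// gt_eqF.
have [nA nA'] : ~ A x /\ ~ A' x by split=> h; apply: nAA'x; [left|right].
rewrite q'0// subr0 normrM ger0_norm//.
have h1 : `|p x| <= B + 1.
  by rewrite (le_trans (pB x))// lerD2l /e' ge_min lexx.
apply: (@le_trans _ _ (d / (B + 1) * (B + 1))); last by rewrite divfK// gt_eqF.
apply: ler_pM => //; exact/ltW/phiA'.
Qed.

(** * The kernel exp(-g) *)

Section ExpKernel.
Context {R : realType} {X : topologicalType} (g : X -> X -> R) (x0 : X).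
Hypothesis ng : cond_neg_def g.
Local Notation C := R[i].
Local Notation K := (exp_kernel g).
Local Notation L := (cnd_base g x0).

Definition base_weight (x : X) : R := expR (- g x x0).

Local Notation phi := base_weight.

Let pL : psd (fun x y => (L x y)%:C). Proof. exact: psd_cnd_base. Qed.

Lemma exp_kernelE x y :
  K x y = (expR (g x0 x0))%:C * (conjc (phi x)%:C * (phi y)%:C * cexp (L x y)%:C).
Proof.
have [gsym _] := ng.
rewrite conjc_real cexp_real -!rmorphM /exp_kernel /base_weight -!expRD.
by congr (expR _)%:C; rewrite /cnd_base (gsym x0 y); ring.
Qed.

Lemma psd_exp_kernel : psd K.
Proof.
have := psdZ _ (psd_wmul (fun x => (phi x)%:C) (psd_cexp pL)).
move=> /(_ (expR (g x0 x0))%:C); rewrite ler0c expR_ge0 => /(_ isT).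
by apply: eq_psd => x y; rewrite -exp_kernelE.
Qed.

Definition base_span : set (X -> R) :=
  [set t | exists w : seq (X * R), t = fun x => \sum_(p <- w) p.2 * L x p.1].

Lemma base_span0 : base_span (fun=> 0).
Proof. by exists [::]; apply/funext => x; rewrite big_nil. Qed.

Lemma base_spanD s t : base_span s -> base_span t -> base_span (fun x => s x + t x).
Proof.
by move=> [w ->] [w' ->]; exists (w ++ w'); apply/funext => x; rewrite big_cat.
Qed.

Lemma base_spanZ (c : R) t : base_span t -> base_span (fun x => c * t x).
Proof.
move=> [w ->]; exists [seq (p.1, c * p.2) | p <- w]; apply/funext => x.
by rewrite big_map mulr_sumr; apply: eq_bigr => p _; rewrite mulrA.
Qed.

Lemma native_expi t : base_span t -> native K (fun x => (phi x)%:C * expi (t x)).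
Proof.
move=> [w ->]; pose Lc x y := (L x y)%:C.
(* Purely imaginary weights represent the point [i z]; the section of the exponential kernel there
   has modulus one. *)
pose wi := [seq (p.1, 0 +i* p.2) | p <- w].
have kE x : cexp (kcomb Lc wi x) = expi (\sum_(p <- w) p.2 * L x p.1).
  have -> : kcomb Lc wi x = 0 +i* (\sum_(p <- w) p.2 * L x p.1).
    rewrite /kcomb big_map; elim/big_rec2: _ => // p a b _ ->.
    by simpc.
  by rewrite /cexp /= expR0 mul1r.
(* The first factor is the domination constant for [wi]; the second cancels the factor
   [expR (g x0 x0)] of [exp_kernelE]. *)
pose a := expR (complex.Re (sform Lc wi wi)) * expR (- g x0 x0).
apply: (@native_dominated _ _ _ _ a); first by rewrite mulr_gt0 ?expR_gt0.
have := psd_wmul (fun x => (phi x)%:C) (psd_cexp_dominates wi pL).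
apply: eq_psd => x y; rewrite -!/(Lc _ _) !kE exp_kernelE.
have -> : cexp (sform Lc wi wi) = (expR (complex.Re (sform Lc wi wi)))%:C.
  have [_ /(_ wi)] := pL; rewrite -/Lc => /ger0_Im.
  by rewrite /cexp => ->; rewrite expi0 mulr1.
have h : (expR (- g x0 x0))%:C * (expR (g x0 x0))%:C = 1 :> C.
  by rewrite -rmorphM -expRD addNr expR0.
rewrite conjcZ conjc_real /a rmorphM /=.
set E := (expR (complex.Re _))%:C; set em := (expR (- _))%:C in h *.
by rewrite (mulrA (E * em)) -(mulrA E em) h mulr1; ring.
Qed.

Lemma native_trigpoly p : trigpoly base_span p ->
  native K (fun x => (phi x * p x)%:C).
Proof.
elim=> {p} [t a Vt|p q _ IHp _ IHq|c p _ IHp].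
- have hp := nativeZ psd_exp_kernel (2^-1%:C * expi a) (native_expi Vt).
  have := nativeZ psd_exp_kernel (2^-1%:C * expi (- a)) (native_expi (base_spanZ (-1) Vt)).
  move=> /(nativeD hp); congr native; apply/funext => x.
  transitivity (2^-1%:C * (phi x)%:C * (expi (t x + a) + expi (- (t x + a)))).
    by rewrite [LHS]/GRing.add/= opprD !expiD mulN1r; ring.
  have -> : expi (t x + a) + expi (- (t x + a)) = (2 * cos (t x + a))%:C.
    by rewrite expiN /expi; simpc; congr (_ +i* _); ring.
  by rewrite -!rmorphM; congr (_%:C); field.
- have := nativeD IHp IHq; congr native; apply/funext => x.
  by rewrite [LHS]/GRing.add/= -rmorphD /= mulrDr.
- have := nativeZ psd_exp_kernel c%:C IHp; congr native; apply/funext => x.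
  by rewrite -rmorphM mulrCA.
Qed.

(** If all sections of [L] agree at [x] and [y], then [L x x - 2 L x y + L y y = 0]. This quantity
    is [2 g x y - g x x - g y y], positive by metrizability. *)
Lemma base_span_separates x y : metrizable g -> x <> y ->
  exists2 t, base_span t & t x <> t y.
Proof.
have [gsym _] := ng; move=> mg xy; apply: contrapT => nt.
have Leq z : L x z = L y z.
  apply: contrapT => h; apply: nt; exists (L^~ z) => //.
  exists [:: (z, 1)]; apply/funext => w.
  by rewrite big_seq1 mul1r.
have := mg _ _ xy; have := Leq x; have := Leq y.
rewrite /cnd_base (gsym y x); lra.
Qed.

Context (cg : continuous (fun p : X * X => g p.1 p.2)).

Lemma continuous_section (y : X) : continuous (g^~ y).
Proof.
move=> x.
apply: (@continuous_comp X (X * X)%type R (fun z => (z, y)) (fun p => g p.1 p.2)).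
  by apply: cvg_pair => //; exact: cvg_cst.
exact: (cg (x := (x, y))).
Qed.

Lemma base_weight_continuous : continuous phi.
Proof.
move=> x; apply: (@cvg_comp _ _ _ (fun z => - g z x0) expR _ (nbhs (- g x x0))).
  by apply: cvgN; exact: continuous_section.
exact: continuous_expR.
Qed.

Lemma base_span_continuous t : base_span t -> continuous t.
Proof.
move=> [w ->] x; apply: (cvg_big (@add_continuous R)) => p _.
apply: cvgMl_tmp; apply: cvgB; last exact: cvg_cst.
apply: cvgB; last exact: continuous_section.
apply: cvgD; last exact: cvg_cst.
exact: continuous_section.
Qed.

Hypothesis mg : metrizable g.
Hypothesis K_C0 : rkhs K `<=` @C0 R X.

(** The weight is the section of the kernel at [x0], a member of the reproducing space. *)
Lemma base_weight_C0 (d : R) : 0 < d ->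
  exists2 A, compact A & forall x, ~ A x -> phi x < d.
Proof.
have : rkhs K (K ^~ x0).
  apply: (native_sub_rkhs psd_exp_kernel).
  have := native_kcomb psd_exp_kernel [:: (x0, 1)]; congr native.
  by apply/funext => x; rewrite kcomb1 mul1r.
move=> /K_C0[_ h] /h[A cA Ah]; exists A => // x /Ah.
by rewrite normc_def /= expr0n addr0 sqrtr_sqr ger0_norm ?expR_ge0// ltcR.
Qed.

Lemma native_approx_real (q : X -> R) (e : R) : continuous q ->
  (forall d : R, 0 < d -> exists2 A, compact A & forall x, ~ A x -> `|q x| < d) ->
  0 < e -> exists2 u : X -> R, native K (fun x => (u x)%:C) &
    forall x, `|u x - q x| <= e.
Proof.
move=> cq qC0 e0.
have [|||||||||p Tp pq] := @weighted_approximation R X (trigpoly base_span) phi q e _ _ _ _ _ _ _ _ _ cq qC0 e0.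
- exact: trigpoly_cst base_span0.
- by move=> p p'; exact: TrigAdd.
- exact: trigpolyM base_spanD base_spanZ.
- exact: trigpoly_bounded.
- by move=> p; apply: trigpoly_continuous; exact: base_span_continuous.
- by move=> x y /(base_span_separates mg)[t Vt]; exact: (trigpoly_separates base_spanZ).
- by move=> x; exact: expR_gt0.
- exact: base_weight_continuous.
- exact: base_weight_C0.
by exists (fun x => phi x * p x) => //; exact: native_trigpoly.
Qed.

Lemma native_approx (f : X -> C) (e : R) : C0 f -> 0 < e ->
  exists2 F, native K F & (sup_dist F f < e%:E)%E.
Proof.
move=> [cf fC0] e0; have e40 : 0 < e / 4 by rewrite divr_gt0.
have cfe x (d : R) : 0 < d -> \forall z \near x, complex.Re `|f x - f z| < d.
  move=> d0; have /cvgrPdist_lt/(_ d%:C) := cf x.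
  rewrite ltcR => /(_ d0); apply: filterS => z.
  by rewrite normE ltcR.
have fC0' (d : R) : 0 < d -> exists2 A, compact A &
    forall x, ~ A x -> complex.Re `|f x| < d.
  by move=> /fC0[A cA h]; exists A => // x /h; rewrite normE ltcR.
have [||u uK uf] := @native_approx_real (fun x => complex.Re (f x)) (e / 4) _ _ e40.
- move=> x; apply/cvgrPdist_lt => d d0; apply: filterS (cfe x d d0) => z.
  rewrite -(raddfB (@complex.Re R : Rcomplex R -> R)).
  exact/le_lt_trans/norm_Re_le.
- move=> d /fC0'[A cA h]; exists A => // x /h; exact/le_lt_trans/norm_Re_le.
have [||v vK vf] := @native_approx_real (fun x => complex.Im (f x)) (e / 4) _ _ e40.
- move=> x; apply/cvgrPdist_lt => d d0; apply: filterS (cfe x d d0) => z.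
  rewrite -(raddfB (@complex.Im R : Rcomplex R -> R)).
  exact/le_lt_trans/norm_Im_le.
- move=> d /fC0'[A cA h]; exists A => // x /h; exact/le_lt_trans/norm_Im_le.
exists (fun x => u x +i* v x).
  have := nativeD uK (nativeZ psd_exp_kernel 'i vK); congr native.
  by apply/funext => x; rewrite [LHS]/GRing.add/=; simpc.
(* Errors of [e / 4] in the real and imaginary parts bound the supremum by [e / 2], leaving room for
   the strict inequality. *)
apply: (@le_lt_trans _ _ (e / 2)%:E); last by rewrite lte_fin; lra.
apply: ge_ereal_sup => _ [x _ <-]; rewrite lee_fin.
rewrite (le_trans (norm_le_ReIm _))//.
have := uf x; have := vf x; case: (f x) => a b /=; lra.
Qed.
End ExpKernel.

(** [pos_def] conjugates the second weight and [sform] the first, so the weights are conjugated in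
    passing. *)
Lemma psd_pos_def {R : realType} {X : Type} (K : X -> X -> R[i]) : psd K -> pos_def K.
Proof.
move=> [_ pK] n x c _.
have := pK [seq (x i, conjc (c i)) | i <- index_enum 'I_n].
rewrite sformE big_map; congr (0 <= _); apply: eq_bigr => i _.
by rewrite big_map; apply: eq_bigr => j _ /=; rewrite conjcK.
Qed.

(** * Universality forces metrizability *)

Section Separation.
Context {R : realType} {X : topologicalType} (g : X -> X -> R).
Local Notation C := R[i].
Local Notation K := (exp_kernel g).

Lemma rkhs_not_metrizable x y F : g x y = g y x -> 2 * g x y <= g x x + g y y ->
  rkhs K F ->
  (expR (g x x / 2))%:C * F x = (expR (g y y / 2))%:C * F y.
Proof.
move=> gxy le_g [H [ip [[[H0 HD HZ iD iZ ih ipos _] HK rep _] HF]]].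
set a := expR (g x x / 2); set b := expR (g y y / 2).
pose Kx : X -> C := fun z => a%:C * K z x.
pose Ky : X -> C := fun z => (- b)%:C * K z y.
have HKx : H Kx by exact: HZ.
have HKy : H Ky by exact: HZ.
have HDD : H (Kx + Ky) by exact: HD.
have ipD G : H G -> ip G (Kx + Ky) = a%:C * G x - b%:C * G y.
  move=> HG; rewrite ih// iD// iZ// iZ// (ih G)// (ih G)// !rep//.
  by case: (G x) => u v; case: (G y) => u' v'; simpc; congr (_ +i* _); ring.
(* The factors [a] and [b] normalise both sections to norm 1. The squared norm of their difference
   is [2 - 2 a b exp (- g x y)], which is at most 0 by [le_g]. *)
have D0 : Kx + Ky = 0.
  apply: contrapT => nD0; have := ipos _ HDD nD0.
  rewrite ipD//.
  have -> : a%:C * (Kx + Ky) x - b%:C * (Kx + Ky) y =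
     (a * a * expR (- g x x) + b * b * expR (- g y y) - 2 * (a * b * expR (- g x y)))%:C.
    rewrite [(Kx + Ky) x]/GRing.add [(Kx + Ky) y]/GRing.add /= /Kx /Ky /exp_kernel -gxy.
    by simpc; congr (_ +i* _); ring.
  have -> : a * a * expR (- g x x) = 1.
    by rewrite /a -!expRD -[RHS]expR0; congr expR; field.
  have -> : b * b * expR (- g y y) = 1.
    by rewrite /b -!expRD -[RHS]expR0; congr expR; field.
  have : 1 <= a * b * expR (- g x y).
    by rewrite /a /b -!expRD -[leLHS]expR0 ler_expR; lra.
  rewrite ltcR; lra.
have := ipD _ HF; rewrite D0.
have -> : ip F 0 = 0.
  have -> : (0 : X -> C) = (fun x => 0 * F x) by apply/funext => z; rewrite mul0r.
  by rewrite ih//; [rewrite iZ// mul0r conjc0|exact: HZ].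
by move/eqP; rewrite eq_sym subr_eq0 => /eqP.
Qed.

Lemma C0_universal_metrizable : hausdorff_space X -> locally_compact [set: X] ->
  (forall x y, g x y = g y x) -> C0_universal K -> metrizable g.
Proof.
move=> hX lX gsym [_ _ dK] x y xy; rewrite ltNge; apply/negP => le_g.
have [U Ux [cU clU]] := lX x I.
have Ux' : nbhs x U by move: Ux; rewrite withinET.
(* A function equal to 0 at [x] and 1 on [B] yields [u = 1 - f], which vanishes outside the compact
   [U] and separates [x] from [y]. *)
pose B := ~` (interior U) `|` [set y].
have clB : closed B.
  apply: closedU; first by apply: open_closedC; exact: open_interior.
  exact/accessible_closed_set1/hausdorff_accessible.
have nBx : ~ B x by case=> [|/= yx]; [apply|exact: xy].
have := locally_compact_completely_regular (R := R) lX hX clB nBx.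
move=> /(uniform_separatorP (R := R))[f [cf _ f0 f1]].
have fx : f x = 0 by apply: f0; exists x.
have fB z : B z -> f z = 1 by move=> Bz; apply: f1; exists z.
pose u z := (1 - f z)%:C.
have uC0 : C0 (u : X -> C).
  split=> [z|e e0].
    apply/cvgrPdist_lt => e e0.
    have eE : e = (complex.Re e)%:C by case: e e0 => a b; rewrite ltcE /= => /andP[/eqP ->].
    have e'0 : 0 < complex.Re e by move: e0; rewrite ltcE => /andP[].
    have /cvgrPdist_lt/(_ _ e'0) := cf z.
    apply: filterS => w fzw; rewrite eE /u -rmorphB normE ltcR.
    apply: (le_lt_trans (norm_le_ReIm _)); rewrite /= normr0 addr0.
    by rewrite opprB addrC addrA subrK distrC.
  exists U => // z nUz; rewrite /u fB; last by left=> /interior_subset.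
  by rewrite subrr normr0 ltcR.
pose a := expR (g x x / 2); pose b := expR (g y y / 2).
have a0 : 0 < a by exact: expR_gt0.
have b0 : 0 < b by exact: expR_gt0.
have ab0 : 0 < a + b by exact: addr_gt0.
(* The tolerance [d = a / (a + b)] solves [a (1 - d) = b d]. Real parts then give
   [a F(x) > a (1 - d) = b d > b F(y)], against the proportionality relation. *)
have [F KF Fu] := dK u uC0 (a / (a + b)) (divr_gt0 a0 ab0).
have Fuz z : complex.Re `|F z - u z| < a / (a + b).
  rewrite -lte_fin; apply: le_lt_trans Fu; apply: ereal_sup_ubound.
  by exists z.
have := rkhs_not_metrizable (gsym x y) le_g KF.
rewrite -/a -/b => /(congr1 (@complex.Re R)).
have ReZ (t : R) (z : C) : complex.Re (t%:C * z) = t * complex.Re z.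
  by case: z => ? ?; rewrite /= mul0r subr0.
rewrite !ReZ => ab.
have := le_lt_trans (norm_Re_le _) (Fuz x); have := le_lt_trans (norm_Re_le _) (Fuz y).
rewrite /u fx fB; last by right.
rewrite !(raddfB (@complex.Re R : Rcomplex R -> R)) /= subrr !subr0 !ltr_norml.
set p := complex.Re (F x) in ab *; set q := complex.Re (F y) in ab *.
move=> /andP[_ qlt] /andP[plt _].
have : a * (1 - a / (a + b)) < a * p by rewrite ltr_pM2l//; lra.
have : b * q < b * (a / (a + b)) by rewrite ltr_pM2l.
have -> : a * (1 - a / (a + b)) = b * (a / (a + b)).
  by field; rewrite gt_eqF.
by rewrite ab; lra.
Qed.
End Separation.

Theorem theorem4p4 (R : realType) (X : topologicalType)
  (hX : hausdorff_space X) (lX : locally_compact [set: X])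
  (g : X -> X -> R)
  (cg : continuous (fun p : X * X => g p.1 p.2))
  (hg : cond_neg_def g) :
  C0_universal (exp_kernel g) <->
  metrizable g /\ rkhs (exp_kernel g) `<=` @C0 R X.
Proof.
split=> [uK|[mg K_C0]].
  by have [_ K_C0 _] := uK; split=> //; apply: C0_universal_metrizable => //; case: hg.
have [[x0 _]|nX] := pselect (exists x0 : X, True).
  have pK := psd_exp_kernel x0 hg.
  split=> //; first exact: psd_pos_def.
  move=> f fC0 e e0; have [F nF Ff] := native_approx x0 hg cg mg K_C0 fC0 e0.
  by exists F => //; exact: native_sub_rkhs nF.
(* Without a base point the space is empty; the supremum is then [-oo], and the zero function
   approximates everything. *)
have X0 (x : X) : False by apply: nX; exists x.
have pK : psd (exp_kernel g).
  split=> [x|[|[x c] s]]; [by case: (X0 x)| |by case: (X0 x)].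
  by rewrite /sform pairing_nil.
split=> //; first exact: psd_pos_def.
move=> f _ e e0; exists 0; first exact: native_sub_rkhs (native0 pK).
apply: (@le_lt_trans _ _ (e / 2)%:E); last by rewrite lte_fin ltr_pdivrMr// ltr_pMr// ltr1n.
by apply: ge_ereal_sup => y [x]; case: (X0 x).
Qed.
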